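(* For every $n\ge1$, the inner product $\langle\mathrm{St}_n\otimes\mathrm{St}_n\otimes\mathrm{St}_n,1\rangle_{\mathrm{GL}_n(\mathbb F_q)}$ is a monic polynomial in $q$ of degree $\frac12(n-1)(n-2)$; that is, there is a monic polynomial $P_n(t)$ of degree $\frac12(n-1)(n-2)$ such that this inner product equals $P_n(q)$ for every finite field $\mathbb F_q$.
   Context: $\mathrm{St}_n$ denotes the (complex) Steinberg character of $\mathrm{GL}_n(\mathbb F_q)$. For class functions $f,h$ on $\mathrm{GL}_n(\mathbb F_q)$, $\langle f,h\rangle_{\mathrm{GL}_n(\mathbb F_q)}=\frac1{|\mathrm{GL}_n(\mathbb F_q)|}\sum_xf(x)\overline{h(x)}$. *)

(* Defs.v *)
From HB Require Import structures.
From mathcomp Require Import all_boot all_order all_algebra all_fingroup.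
From mathcomp Require Import all_solvable all_field all_character.

Set Implicit Arguments.
Unset Strict Implicit.
Unset Printing Implicit Defensive.

Import Order.TTheory GRing.Theory Num.Theory.
Local Open Scope ring_scope.

(* A matrix g is in standard_parabolic S when g a b = 0 for all b <= i < a with
   i in S, i.e. when it is block upper triangular with a cut between the
   (0-based) positions i and i+1 for each i in S.  So S is the complement of
   the set of simple roots attached to the parabolic subgroup: S = setT gives
   the Borel subgroup, S = set0 gives the whole of GL_n. *)
Definition standard_parabolic (n : nat) (F : finFieldType) (S : {set 'I_n.-1}) :
    {set {'GL_n[F]}} :=
  [set g : {'GL_n[F]} | [forall i in S, forall a : 'I_n.-1.+1, forall b : 'I_n.-1.+1,
     (b <= i < a)%N ==> (GLval g a b == 0)]].

Lemma standard_parabolicP (n : nat) (F : finFieldType) (S : {set 'I_n.-1})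
    (g : {'GL_n[F]}) :
  reflect (forall (i : 'I_n.-1) (a b : 'I_n.-1.+1),
             i \in S -> (b <= i < a)%N -> GLval g a b = 0)
          (g \in standard_parabolic F S).
Proof.
rewrite inE; apply: (iffP idP) => [/forall_inP H i a b iS ab|H].
  by have /forallP/(_ a)/forallP/(_ b)/implyP/(_ ab)/eqP := H i iS.
apply/forall_inP => i iS; apply/forallP => a; apply/forallP => b.
by apply/implyP => ab; apply/eqP; apply: H ab.
Qed.

Lemma standard_parabolic_group_set (n : nat) (F : finFieldType)
    (S : {set 'I_n.-1}) : group_set (standard_parabolic F S).
Proof.
apply/group_setP; split=> [|g h /standard_parabolicP Hg /standard_parabolicP Hh].
  apply/standard_parabolicP => i a b _ /andP[bi ia].
  rewrite GL_1E /= mxE; case: eqP => // ab.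
  by move: (leq_ltn_trans bi ia); rewrite ab ltnn.
apply/standard_parabolicP => i a b iS /andP[bi ia].
rewrite GL_ME mxE big1 // => k _.
have [ki|ik] := leqP k i; first by rewrite (Hg i) ?mul0r // ki ia.
by rewrite (Hh i) ?mulr0 // bi ik.
Qed.

Canonical standard_parabolic_group (n : nat) (F : finFieldType)
  (S : {set 'I_n.-1}) := Group (standard_parabolic_group_set F S).

(* St_n = \sum_J (-1)^|J| Ind_(P_J)^(GL_n) 1 over the sets J of simple roots,
   with P_J = standard_parabolic (~: J); the Borel subgroup has sign +1. *)
Definition steinberg (n : nat) (F : finFieldType) : 'CF('GL_n[F]) :=
  \sum_(J : {set 'I_n.-1})
     (-1) ^+ #|J| *: 'Ind['GL_n[F], standard_parabolic F (~: J)] 1.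

(* Main.v *)
(* By its definition as an alternating sum over flags, St_n(g) is (-1)^n times the
   Moebius number mu(g) of the lattice of g-stable subspaces.  If L is a simple
   g-stable subspace, Weisner's theorem gives mu(g) = - c mu(g on V/L), where c is the
   number of g-stable complements of L; hence mu(g) vanishes unless g is semisimple,
   and then depends only on the characteristic polynomial f of g.  Counting pairs
   (g, L), the sum of mu^3 / |GL_n| over the g with characteristic polynomial
   f = prod p^k is the product over p of
     w(Q, k) = prod_(i < k) - Q^(2i) / (Q^(i+1) - 1),   Q = q^(deg p),
   so that (-1)^n <St_n^3, 1> is the coefficient of x^n in the Euler product
     prod_(p <> X) sum_k w(q^(deg p), k) x^(k deg p).
   The same Euler product with w = 1 shows that the number of irreducible p of each
   degree is a polynomial in q, so <St_n^3, 1> is a rational function of q.  It is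
   equivalent to q^((n-1)(n-2)/2): since (i-1)(i-2)/2 is superadditive, only the
   polynomials (X - a)^n contribute to the leading term when n > 2.  Finally, it takes
   integer values at all prime powers, hence it is a polynomial. *)

Require Import Defs.
From HB Require Import structures.
From mathcomp Require Import all_boot all_order all_algebra all_fingroup.
From mathcomp Require Import all_solvable all_field all_character.
From mathcomp Require Import ring zify.

Set Implicit Arguments.
Unset Strict Implicit.
Unset Printing Implicit Defensive.

Import Order.TTheory GRing.Theory Num.Theory.
Local Open Scope ring_scope.

(** * Moebius numbers of lattices of stable subspaces *)

(** Moebius numbers obey Weisner's recursion, which splits off one simple subspace at a time and
    asks for no description of the conjugacy classes and centralizers of GL_n. The exponent has a
    local origin. With Q = q^d, the weight w(Q, k) has order Q^(k(k-3)/2), and there are about Q/d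
    polynomials p of degree d; together this is q^(d t(k)) with t(k) = (k-1)(k-2)/2. A product of
    several p^k thus has order q to the sum of the d t(k), against q^t(n) for (X-a)^n. Degree 2 is
    exceptional: (X-a)(X-b) with a and b distinct, and the irreducible quadratics, also reach the
    top order, but they contribute 1/2 and -1/2 and cancel. The number of Euler factors grows with
    q, so the factors of one degree are collected into a power (1+U)^N and expanded by the binomial
    theorem over a range that depends on n alone. A single predicate records both the rational
    expression and its growth: division with remainder needs the former, the degree and leading
    coefficient the latter. *)

Definition chain (T : finType) (lt : rel T) (c : {set T}) : bool :=
  [forall x in c, forall y in c, [|| x == y, lt x y | lt y x]].

Definition below (T : finType) (lt : rel T) (c : {set T}) (x : T) : bool :=
  [forall y in c, lt y x].

Definition chain_sum (T : finType) (lt : rel T) (x : T) : rat :=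
  \sum_(c : {set T} | chain lt c && below lt c x) (-1) ^+ #|c|.

Lemma chainP (T : finType) (lt : rel T) (c : {set T}) :
  reflect {in c &, forall x y, [|| x == y, lt x y | lt y x]} (chain lt c).
Proof.
apply: (iffP forall_inP) => [H x y xc yc|H x xc].
  by have /forall_inP/(_ y yc) := H x xc.
by apply/forall_inP => y yc; apply: H.
Qed.

Lemma belowP (T : finType) (lt : rel T) (c : {set T}) (x : T) :
  reflect {in c, forall y, lt y x} (below lt c x).
Proof. exact: forall_inP. Qed.

Lemma chain_max (T : finType) (lt : rel T) (rho : T -> nat)
    (lt_rho : forall x y, lt x y -> (rho x < rho y)%N) (c : {set T}) :
  chain lt c -> c != set0 ->
  exists2 y, y \in c & below lt (c :\ y) y.
Proof.
move=> /chainP cc /set0Pn[x0 x0c].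
case: (@arg_maxnP _ x0 [in c] rho x0c) => y yc ymax; exists y => //.
apply/belowP => z; rewrite !inE => /andP[zy zc].
case/or3P: (cc z y zc yc) => [|//|/lt_rho]; first by rewrite (negbTE zy).
by rewrite ltnNge => /negP[]; apply: ymax.
Qed.

(* A nonempty chain is determined by its largest element and the chain below it. *)
Lemma chain_sum_rec (T : finType) (lt : rel T) (rho : T -> nat)
    (lt_tr : transitive lt)
    (lt_rho : forall x y, lt x y -> (rho x < rho y)%N) (x : T) :
  chain_sum lt x = 1 - \sum_(y | lt y x) chain_sum lt y.
Proof.
have irr y : lt y y = false by apply/negP => /lt_rho; rewrite ltnn.
pose top (c : {set T}) y := (y \in c) && below lt (c :\ y) y.
have topU c y z : top c y -> top c z -> y = z.
  case/andP=> yc /belowP by_; case/andP=> zc /belowP bz; apply/eqP.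
  apply: contraFT (irr y) => yz.
  apply: (lt_tr z); first by apply: bz; rewrite !inE yz.
  by apply: by_; rewrite !inE eq_sym yz.
rewrite /chain_sum (bigD1 set0) /=; last first.
  apply/andP; split; first by apply/chainP => y z; rewrite inE.
  by apply/belowP => y; rewrite inE.
rewrite cards0 expr0; congr (_ + _).
transitivity (\sum_(c : {set T} | [&& chain lt c, below lt c x & c != set0])
   \sum_(y | lt y x && top c y) (-1 : rat) ^+ #|c|).
  apply: eq_big => [c|c]; first by rewrite andbA.
  case/andP=> /andP[cc /belowP cx] c0.
  have [y yc yb] := chain_max lt_rho cc c0.
  have ty : top c y by apply/andP.
  rewrite (big_pred1 y) // => z; apply/andP/eqP => [[_ tz]|->].
    exact: topU tz ty.
  by split=> //; exact: cx.
rewrite (exchange_big_dep (lt^~ x)) /=; last by move=> c y _ /andP[].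
rewrite -sumrN; apply: eq_bigr => y yx.
rewrite -sumrN (reindex_onto (fun c => y |: c) (fun c => c :\ y)) /=; last first.
  move=> c /andP[_ /andP[_ /andP[yc _]]]; exact: setD1K.
apply: eq_big => [c|c].
  rewrite /top setU11 yx /=.
  have -> : ((y |: c) :\ y == c) = (y \notin c).
    by apply/eqP/idP => [<-|/setU1K//]; rewrite !inE eqxx.
  apply/idP/idP.
    move=> /andP[/andP[/and3P[/chainP cc /belowP bb _] bc] yc].
    rewrite setU1K // in bc; rewrite bc andbT; apply/chainP => u v uc vc.
    by apply: cc; rewrite !inE ?uc ?vc orbT.
  move=> /andP[/chainP cc bc].
  have yc : y \notin c by apply/negP => /(belowP _ _ _ bc); rewrite irr.
  rewrite setU1K // bc yc !andbT; apply/and3P; split.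
  - apply/chainP => u v; rewrite !inE => /orP[/eqP->|uc] /orP[/eqP->|vc].
    + by rewrite eqxx.
    + by rewrite ((belowP _ _ _ bc) v vc) !orbT.
    + by rewrite ((belowP _ _ _ bc) u uc) !orbT.
    + exact: cc.
  - apply/belowP => u; rewrite !inE => /orP[/eqP->//|uc].
    exact: lt_tr ((belowP _ _ _ bc) u uc) yx.
  - by apply/set0Pn; exists y; rewrite setU11.
by case/andP=> _ /eqP yc; rewrite cardsU1 -{1}yc !inE eqxx exprD expr1 mulN1r.
Qed.

(* Subspaces of F^n are represented by the matrices U with <<U>> = U. *)
Definition stsub (F : fieldType) (n : nat) (g U : 'M[F]_n) : bool :=
  (<<U>>%MS == U) && stablemx U g.

Definition sub_lt (F : fieldType) (n : nat) (g : 'M[F]_n) : rel 'M[F]_n :=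
  fun U W => [&& stsub g U, U != 0 & (U < W)%MS].

(** Philip Hall's formula for mu(0, W): adding 0 and W to a chain [c] of nonzero stable subspaces
    strictly below [W] gives a chain of length [#|c| + 1], whence the sign. *)
Definition moebius (F : finFieldType) (n : nat) (g W : 'M[F]_n) : rat :=
  if W == 0 then 1 else - chain_sum (sub_lt g) W.

Lemma sub_lt_trans (F : fieldType) (n : nat) (g : 'M[F]_n) :
  transitive (sub_lt g).
Proof.
move=> V U W /and3P[sU U0 UV] /and3P[_ _ VW]; rewrite /sub_lt sU U0 /=.
exact: ltmx_trans UV VW.
Qed.

Lemma sub_lt_rank (F : fieldType) (n : nat) (g U W : 'M[F]_n) :
  sub_lt g U W -> (\rank U < \rank W)%N.
Proof. by case/and3P=> _ _; apply: rank_ltmx. Qed.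

Lemma genmx_eqP (F : fieldType) (n : nat) (U W : 'M[F]_n) :
  <<U>>%MS = U -> <<W>>%MS = W -> (U :=: W)%MS -> U = W.
Proof. by move=> <- <- /eqmxP/genmxP; rewrite !genmx_id. Qed.

Lemma genmx_fix (F : fieldType) (m n : nat) (A : 'M[F]_(m, n)) (U : 'M[F]_n) :
  <<U>>%MS = U -> (A :=: U)%MS -> <<A>>%MS = U.
Proof. by move=> {2}<- /eq_genmx. Qed.

Lemma stsub0 (F : fieldType) (n : nat) (g : 'M[F]_n) : stsub g 0.
Proof. by rewrite /stsub genmx0 eqxx stable0mx. Qed.

Lemma stsub1 (F : fieldType) (n : nat) (g : 'M[F]_n) : stsub g 1%:M.
Proof. by rewrite /stsub genmx1 eqxx stableCmx. Qed.

Lemma stsub_gen (F : fieldType) (m n : nat) (g : 'M[F]_n) (U : 'M[F]_(m, n)) :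
  stsub g <<U>>%MS = stablemx U g.
Proof. by rewrite /stsub genmx_id eqxx /= (eqmx_stable g (genmxE U)). Qed.

Lemma moebius_sum (F : finFieldType) (n : nat) (g W : 'M[F]_n) :
  stsub g W ->
  \sum_(U | stsub g U && (U <= W)%MS) moebius g U = (W == 0)%:R.
Proof.
move=> sW; rewrite (bigD1 0) ?stsub0 ?sub0mx //= {1}/moebius eqxx.
have [->|W0] := eqVneq W 0.
  rewrite big1 ?addr0 // => U /andP[/andP[_]]; rewrite submx0 => /eqP->.
  by rewrite eqxx.
rewrite (bigD1 W) ?sW ?submx_refl //= {1}/moebius (negbTE W0).
rewrite (chain_sum_rec (@sub_lt_trans _ _ g) (@sub_lt_rank _ _ g)).
set S := \sum_(U | sub_lt g U W) _.
suff -> : \sum_(U | (stsub g U && (U <= W)%MS && (U != 0)) && (U != W))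
    moebius g U = - S by rewrite mulr0n; ring.
rewrite /S -sumrN; apply: eq_big => [U|U]; last first.
  by case/andP=> /andP[_ /negbTE U0] _; rewrite /moebius U0.
rewrite /sub_lt; case sU: (stsub g U) => //=.
rewrite andbAC andbC; congr (_ && _); rewrite ltmxEneq; congr (_ && _).
congr (~~ _); apply/eqP/eqmxP => [->|UW]; first exact: eqmx_refl.
by case/andP: sU sW => /eqP cU _ /andP[/eqP cW _]; apply: genmx_eqP.
Qed.

(** Weisner's theorem. Sorting the stable [U] inside [W] by the join of [U] and [L] splits the
    vanishing sum of [moebius_sum] into sums of the same shape, and those with a join smaller than
    [W] vanish by induction. *)
Lemma moebius_weisner (F : finFieldType) (n : nat) (g L W : 'M[F]_n) :
  stsub g L -> L != 0 -> stsub g W -> (L <= W)%MS ->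
  \sum_(U | stsub g U && (<<(U + L)%MS>>%MS == W)) moebius g U = 0.
Proof.
move=> sL L0; have [r] := ubnP (\rank W).
elim: r W => // r IH W /ltnSE rW sW LW.
have W0 : W != 0 by apply: contraNneq L0 => W0; rewrite -submx0 -W0.
have := moebius_sum sW; rewrite (negbTE W0) mulr0n.
rewrite (partition_big (fun U => <<(U + L)%MS>>%MS)
           (fun Y => [&& stsub g Y, (L <= Y)%MS & (Y <= W)%MS])) /=; last first.
  move=> U /andP[/andP[_ sU] UW]; rewrite stsub_gen !genmxE addsmxSr.
  rewrite addsmx_sub UW LW; case/andP: sL => _ sL.
  by rewrite stableDmx.
rewrite (bigD1 W) /= ?sW ?LW ?submx_refl // [X in _ + X = _]big1 ?addr0 => [|Y].
  move=> H; rewrite -[RHS]H; apply: eq_bigl => U; case sU: (stsub g U) => //=.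
  apply/idP/andP => [/eqP UW|[]//]; rewrite -UW genmxE addsmxSl.
  by rewrite eqxx.
case/andP=> /and3P[sY LY YW] YnW.
rewrite -[RHS](IH Y) //; last first.
  apply: leq_trans rW; apply: rank_ltmx; rewrite ltmxE YW /=.
  apply: contra YnW => WY; apply/eqP.
  case/andP: sY sW => /eqP cU _ /andP[/eqP cW _]; apply: genmx_eqP => //.
  by apply/eqmxP; rewrite YW.
apply: eq_bigl => U; rewrite -andbA; congr (_ && _).
case: eqP => [UY|]; last by rewrite andbF.
by rewrite andbT; apply: submx_trans YW; rewrite -UY genmxE addsmxSl.
Qed.

(** Multiplication by [M] is an isomorphism from the lattice of [h]-stable subspaces onto that of
    the [g]-stable subspaces of the row space of [M], and both Moebius functions satisfy the same
    recursion. *)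
Lemma moebius_embed (F : finFieldType) (m n : nat) (g : 'M[F]_n)
    (h W : 'M[F]_m) (M : 'M[F]_(m, n)) :
  row_free M -> M *m g = h *m M -> stsub h W ->
  moebius g <<W *m M>>%MS = moebius h W.
Proof.
move=> fM Mg; have [r] := ubnP (\rank W).
elim: r W => // r IH W /ltnSE rW sW.
have [M' MM'] := row_freeP fM.
have eq0 k (A : 'M_(k, m)) : (A *m M == 0) = (A == 0).
  by apply/eqP/eqP => [|->]; [move/(congr1 (mulmx^~ M')); rewrite -mulmxA MM' mulmx1 mul0mx | rewrite mul0mx].
have [W0|W0] := eqVneq W 0.
  by rewrite /moebius W0 mul0mx genmx0 !eqxx.
have st k (A : 'M_(k, m)) : stablemx A h -> stablemx (A *m M) g.
  by move=> sA; rewrite -mulmxA Mg mulmxA submxMr.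
have stsubM A : stsub h A -> stsub g <<A *m M>>%MS.
  by case/andP=> _ sA; rewrite stsub_gen st.
have sgW := stsubM _ sW.
have := moebius_sum sgW; have := moebius_sum sW.
rewrite -!mxrank_eq0 genmxE !mxrank_eq0 eq0 (negbTE W0) => h1 h2.
move: h1; rewrite (bigD1 W) ?sW ?submx_refl //= => /eqP; rewrite addr_eq0 => /eqP->.
move: h2; rewrite (bigD1 <<W *m M>>%MS) ?sgW ?submx_refl //= => /eqP.
rewrite addr_eq0 => /eqP->; congr (- _).
have VMK U : (U <= <<W *m M>>)%MS -> (U *m M' *m M :=: U)%MS.
  rewrite genmxE => /submxP[D ->].
  by rewrite -!mulmxA (mulmxA M) MM' mul1mx.
have subM A B : (A *m M <= B *m M)%MS = (A <= B)%MS.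
  by apply/idP/idP => [/(submxMr M')|/submxMr->//]; rewrite -!mulmxA MM' !mulmx1.
have VM A : (<<A *m M>> *m M' :=: A)%MS.
  apply: eqmx_trans (eqmxMr _ (genmxE _)) _.
  by rewrite -mulmxA MM' mulmx1.
rewrite (reindex_onto (fun V : 'M_m => <<V *m M>>%MS) (fun U => <<U *m M'>>%MS)) /=; last first.
  move=> U /andP[/andP[/andP[/eqP cU _] UW] _]; apply: genmx_fix cU _.
  exact: eqmx_trans (eqmxMr _ (genmxE _)) (VMK _ _ UW).
have VV A : stsub h A -> <<<<A *m M>> *m M'>>%MS = A.
  by case/andP=> /eqP cA _; apply: genmx_fix (VM _ _).
apply: eq_big => [V|V].
  apply/idP/idP.
    move=> /andP[/andP[/andP[sV VW] VnW] /eqP eV].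
    have cV : <<V>>%MS = V by rewrite -eV genmx_id.
    rewrite !genmxE subM in VW; rewrite VW /stsub cV eqxx.
    rewrite stsub_gen in sV.
    have -> : stablemx V h by rewrite -subM -mulmxA -Mg mulmxA.
    by rewrite /=; apply: contraNneq VnW => ->.
  move=> /andP[/andP[sV VW] VnW]; rewrite stsubM // !genmxE subM VW /= VV // eqxx.
  rewrite andbT; apply: contra VnW => /eqP e.
  by rewrite -(VV V sV) e VV.
move=> /andP[/andP[/andP[sV VW] VnW] /eqP eV].
have sV' : stsub h V.
  rewrite /stsub -{1}eV genmx_id eV eqxx /=.
  by rewrite stsub_gen in sV; rewrite -subM -mulmxA -Mg mulmxA.
rewrite !genmxE subM in VW.
rewrite IH //; apply: leq_trans rW; apply: rank_ltmx.
rewrite ltmxE VW /=; apply: contra VnW => WV; apply/eqP.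
by congr (<<_ *m _>>%MS); case/andP: sV' sW => /eqP cV _ /andP[/eqP cW _];
  apply: genmx_eqP => //; apply/eqmxP; rewrite VW.
Qed.

(** * The Steinberg character as a Moebius number *)

(** Row vectors are acted on from the right, so block upper triangular matrices stabilize spans of
    the last basis vectors; [copid_mx i.+1] spans the e_a with a > i. *)
Lemma parabolic_stable (n : nat) (F : finFieldType) (S : {set 'I_n.-1})
    (g : {'GL_n[F]}) :
  (g \in standard_parabolic F S) =
  [forall i in S, stablemx (copid_mx i.+1 : 'M_n.-1.+1) (GLval g)].
Proof.
have st (i : 'I_n.-1) : stablemx (copid_mx i.+1 : 'M_n.-1.+1) (GLval g) <->
    forall a b : 'I_n.-1.+1, (b <= i < a)%N -> GLval g a b = 0.
  have le_n : (i.+1 <= n.-1.+1)%N by rewrite ltnS ltnW.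
  have E a b : (copid_mx i.+1 *m GLval g *m pid_mx i.+1 : 'M_n.-1.+1) a b =
      GLval g a b *+ (b <= i < a)%N.
    rewrite -mulmxA mulmxBl mul1mx !mxE.
    rewrite (bigD1 b) //= big1 ?addr0 => [|k kb]; last first.
      by rewrite [pid_mx _ _ _]mxE (inj_eq val_inj) (negbTE kb) mulr0.
    rewrite (bigD1 a) //= big1 ?addr0 => [|k ka]; last first.
      by rewrite [pid_mx _ _ _]mxE (inj_eq val_inj) eq_sym (negbTE ka) mul0r.
    rewrite !mxE (bigD1 b) //= big1 ?addr0 => [|k kb]; last first.
      by rewrite [pid_mx _ _ _]mxE (inj_eq val_inj) (negbTE kb) mulr0.
    rewrite !mxE !eqxx /= !ltnS [(i < a)%N]ltnNge.
    by case: (b <= i)%N; case: (a <= i)%N;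
       rewrite /= ?mulr1 ?mulr0 ?mul1r ?mul0r ?subrr ?subr0 ?mulr0n.
  split=> [sg a b ab|H].
    have := E a b; rewrite ab mulr1n => <-.
    case/submxP: sg => D ->.
    by rewrite -mulmxA mul_copid_mx_pid // mulmx0 mxE.
  apply/submxP; exists (copid_mx i.+1 *m GLval g).
  rewrite mulmxBr mulmx1; apply/matrixP => a b.
  rewrite [RHS]mxE [X in _ + X]mxE E.
  by case: (boolP (_ && _)) => [/H->|_]; rewrite ?mulr0n ?mul0rn ?subr0.
apply/standard_parabolicP/forall_inP => [H i iS|H i a b iS].
  by apply/st => a b; apply: H.
by have /st := H i iS; apply.
Qed.

Lemma copid_mx_block (R : pzRingType) (s r k : nat) :
  copid_mx (s + k) = block_mx 0 0 0 (copid_mx k) :> 'M[R]_(s + r).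
Proof.
rewrite /copid_mx scalar_mx_block; apply/matrixP => i j; rewrite !mxE.
case: splitP => i' Ei; rewrite !mxE; case: splitP => j' Ej; rewrite !mxE Ei Ej.
- by rewrite eqn_leq ltn_addr // andbT -eqn_leq -(inj_eq val_inj) /= subrr.
- have -> : (i' == s + j' :> nat)%N = false.
    by apply/negbTE; rewrite neq_ltn (leq_trans (ltn_ord i')) ?leq_addr.
  by rewrite /= subrr.
- have -> : (s + i' == j' :> nat)%N = false.
    by apply/negbTE; rewrite neq_ltn orbC (leq_trans (ltn_ord j')) ?leq_addr.
  by rewrite /= subrr.
by rewrite eqn_add2l ltn_add2l.
Qed.

(** Induction on the chain: a basis adapted to the part below the largest member [T] is completed to
    one of [M] by a basis of a complement of [T]. The new rows go on top, since members of the chain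
    are to be spanned by the last rows. *)
Lemma adapted_basis (F : finFieldType) (n : nat) (lt : rel 'M[F]_n)
    (lt_sub : forall U W, lt U W -> (U < W)%MS) (c : {set 'M[F]_n}) (M : 'M[F]_n) :
  chain lt c -> (forall U, U \in c -> (U <= M)%MS) ->
  exists r (A : 'M_(r, n)), [/\ row_free A, (A :=: M)%MS &
    forall U, U \in c -> (copid_mx (r - \rank U) *m A :=: U)%MS].
Proof.
have lt_rk U W : lt U W -> (\rank U < \rank W)%N by move/lt_sub/rank_ltmx.
have [k] := ubnP #|c|; elim: k c M => // k IH c M /ltnSE ck cc cM.
have [c0|cn0] := eqVneq c set0.
  exists (\rank M), (row_base M); split; [exact: row_base_free|exact: eq_row_base|].
  by move=> U; rewrite c0 inE.
have [T Tc /belowP cT] := chain_max lt_rk cc cn0.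
have [|||r [A [fA AT bA]]] := IH (c :\ T) T.
- by apply: leq_trans ck; rewrite [in X in (_ < X)%N](cardsD1 T) Tc.
- apply/chainP => U W /setD1P[_ Uc] /setD1P[_ Wc].
  exact: (chainP _ _ cc).
- by move=> U /cT/lt_sub/ltmxW.
have rT : r = \rank T by rewrite -AT; apply/esym/eqP.
exists (\rank (M :\: T)%MS + r)%N, (col_mx (row_base (M :\: T)%MS) A).
have EM : (col_mx (row_base (M :\: T)%MS) A :=: M)%MS.
  apply/eqmxP/andP; split.
    by rewrite col_mx_sub eq_row_base diffmxSl AT cM.
  rewrite -addsmxE (adds_eqmx (eq_row_base _) AT) -{1}(addsmx_diff_cap_eq M T).
  by rewrite addsmxS ?capmxSr.
split=> //.
  rewrite /row_free EM -(mxrank_cap_compl M T) addnC rT; apply/eqP; congr (_ + _)%N.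
  by apply/eqP; rewrite eqn_leq !mxrankS ?capmxSr ?sub_capmx ?cM ?submx_refl.
move=> U Uc.
have UT : (\rank U <= r)%N.
  rewrite rT; have [->//|UnT] := eqVneq U T.
  by apply/ltnW/lt_rk/cT; rewrite !inE UnT.
rewrite -addnBA // copid_mx_block mul_block_col !mul0mx addr0 add0r.
have E : (copid_mx (r - \rank U) *m A :=: U)%MS.
  have [->|UnT] := eqVneq U T; last by apply: bA; rewrite !inE UnT.
  by rewrite -rT subnn /copid_mx pid_mx_0 subr0 mul1mx.
exact: eqmx_trans (eqmx_trans (eqmx_sym (addsmxE _ _)) (adds0mx _ _)) E.
Qed.

Lemma stablemx_unit_eq (F : fieldType) (m n : nat) (V : 'M[F]_(m, n)) (p : 'M[F]_n) :
  p \in unitmx -> stablemx V p -> (V *m p :=: V)%MS.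
Proof.
move=> up sV; apply/eqmxP; rewrite sV /=.
by rewrite -(geq_leqif (mxrank_leqif_sup sV)) mxrankMfree ?row_free_unit.
Qed.

Lemma GLval_conjV (n : nat) (F : finFieldType) (g h : {'GL_n[F]}) :
  GLval (g ^ h^-1)%g = GLval h *m GLval g *m invmx (GLval h).
Proof.
rewrite /conjg.
rewrite invgK.
rewrite GL_MxE.
rewrite GL_MxE.
by rewrite GL_VxE mulmxA.
Qed.

Definition flag (n : nat) (F : finFieldType) (S : {set 'I_n.-1}) (h : {'GL_n[F]}) :
    {set 'M[F]_n.-1.+1} :=
  [set <<(copid_mx (val i).+1 : 'M_n.-1.+1) *m GLval h>>%MS | i : 'I_n.-1 in S].

Lemma flag_rank (n : nat) (F : finFieldType) (h : {'GL_n[F]}) (i : 'I_n.-1) :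
  \rank <<(copid_mx i.+1 : 'M_n.-1.+1) *m GLval h>>%MS = (n.-1 - i)%N.
Proof.
rewrite genmxE mxrankMfree ?row_free_unit ?GL_unitmx //.
by rewrite rank_copid_mx ?subSS // ltnS ltnW.
Qed.

Lemma flag_term_inj (n : nat) (F : finFieldType) (h k : {'GL_n[F]}) (i j : 'I_n.-1) :
  <<(copid_mx i.+1 : 'M_n.-1.+1) *m GLval h>>%MS =
  <<(copid_mx j.+1 : 'M_n.-1.+1) *m GLval k>>%MS -> i = j.
Proof.
move/(congr1 (fun A => \rank A)); rewrite !flag_rank => E; apply: val_inj => /=.
by have := ltn_ord i; have := ltn_ord j; lia.
Qed.

Lemma flag_type_inj (n : nat) (F : finFieldType) (S S' : {set 'I_n.-1})
    (h k : {'GL_n[F]}) : flag S h = flag S' k -> S = S'.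
Proof.
move=> E; apply/setP => i; apply/idP/idP => iS.
  have : <<(copid_mx i.+1 : 'M_n.-1.+1) *m GLval h>>%MS \in flag S' k.
    by rewrite -E; apply: imset_f.
  by case/imsetP=> j jS' /flag_term_inj->.
have : <<(copid_mx i.+1 : 'M_n.-1.+1) *m GLval k>>%MS \in flag S h.
  by rewrite E; apply: imset_f.
by case/imsetP=> j jS' /flag_term_inj->.
Qed.

Lemma card_flag (n : nat) (F : finFieldType) (S : {set 'I_n.-1}) (h : {'GL_n[F]}) :
  #|flag S h| = #|S|.
Proof. by apply: card_imset => i j; apply: flag_term_inj. Qed.

(** Flags of type [S] are the right cosets of the parabolic subgroup; this turns the sum over the
    group in an induced character into a sum over flags. *)
Lemma flag_fiber (n : nat) (F : finFieldType) (S : {set 'I_n.-1}) (k : {'GL_n[F]}) :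
  [set h | flag S h == flag S k] = (standard_parabolic F S :* k)%g.
Proof.
apply/setP => h; rewrite inE mem_rcoset parabolic_stable.
apply/eqP/forall_inP => [E i iS|H].
  have : <<(copid_mx i.+1 : 'M_n.-1.+1) *m GLval h>>%MS \in flag S k.
    by rewrite -E; apply: imset_f.
  case/imsetP=> j _ Eij; move: (Eij) => /flag_term_inj ij; rewrite -ij in Eij.
  have/genmxP/eqmxP Eq := Eij.
  rewrite GL_MxE GL_VxE mulmxA (eqmxMr _ Eq) mulmxK ?GL_unitmx //.
rewrite /flag; apply: eq_in_imset => i iS; apply: eq_genmx.
have := H i iS; set p := GLval _ => sp.
have up : p \in unitmx by apply: GL_unitmx.
have Ei := stablemx_unit_eq up sp.
have -> : GLval h = p *m GLval k by rewrite /p -GL_MxE mulgKV.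
by rewrite mulmxA; apply: eqmxMr.
Qed.

Lemma copid_mx_sub (F : fieldType) (n i j : nat) :
  (i <= j <= n)%N -> (copid_mx j <= (copid_mx i : 'M[F]_n))%MS.
Proof.
case/andP=> ij jn; apply/submxP; exists (copid_mx j).
rewrite [in RHS]/copid_mx [RHS]mulmxBr mulmx1.
have E : pid_mx i = pid_mx j *m (pid_mx i : 'M_n) :> 'M[F]_n.
  by rewrite mul_pid_mx (minn_idPr ij) (minn_idPr (leq_trans ij jn)).
by rewrite E mulmxA mul_copid_mx_pid // mul0mx subr0.
Qed.

(** The members of a flag are always nested, nonzero and proper, so only their stability is at
    stake. *)
Lemma flag_good (n : nat) (F : finFieldType) (g h : {'GL_n[F]}) (S : {set 'I_n.-1}) :
  (chain (sub_lt (GLval g)) (flag S h) && below (sub_lt (GLval g)) (flag S h) 1%:M)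
  = [forall i in S, stablemx ((copid_mx i.+1 : 'M_n.-1.+1) *m GLval h) (GLval g)].
Proof.
apply/andP/forall_inP => [[_ /belowP H] i iS|H].
  have /and3P[] := H _ (imset_f _ iS).
  by rewrite stsub_gen.
have lt0 (i : 'I_n.-1) : <<(copid_mx i.+1 : 'M_n.-1.+1) *m GLval h>>%MS != 0.
  by rewrite -mxrank_eq0 flag_rank -lt0n subn_gt0.
split.
  apply/chainP => _ _ /imsetP[i iS ->] /imsetP[j jS ->].
  wlog ij : i j iS jS / (i <= j)%N.
    move=> W; have [/W|/ltnW/W] := leqP i j; first exact.
    by case/(_ jS iS)/or3P=> [/eqP->|->|->]; rewrite ?eqxx ?orbT.
  have [->|nij] := eqVneq i j; first by rewrite eqxx.
  apply/or3P/Or33; rewrite /sub_lt stsub_gen H // lt0 /= ltmxErank !genmxE.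
  apply/andP; split.
    by apply/submxMr/copid_mx_sub; rewrite ltnS ij ltnS ltnW.
  have := flag_rank h i; have := flag_rank h j; rewrite !genmxE => -> ->.
  have nij' : i != j :> nat by rewrite (inj_eq val_inj).
  by have := ltn_ord i; have := ltn_ord j; move: ij nij'; lia.
apply/belowP => _ /imsetP[i iS ->].
rewrite /sub_lt stsub_gen H // lt0 /= ltmxErank submx1 /= flag_rank mxrank1; lia.
Qed.

Lemma flag_exists (n : nat) (F : finFieldType) (g : {'GL_n[F]})
    (c : {set 'M[F]_n.-1.+1}) :
  chain (sub_lt (GLval g)) c -> below (sub_lt (GLval g)) c 1%:M ->
  exists S, exists h : {'GL_n[F]}, flag S h = c.
Proof.
move=> cc /belowP cb.
have [||r [A [fA A1 bA]]] := @adapted_basis _ _ (sub_lt (GLval g)) _ c 1%:M cc.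
- by move=> U W /and3P[].
- by move=> U _; apply: submx1.
have rn : r = n.-1.+1 by move/eqP: fA => <-; rewrite A1 mxrank1.
move: A fA A1 bA; rewrite rn => A fA _ bA.
have uA : A \in unitmx by rewrite -row_free_unit.
pose h : {'GL_n[F]} := Sub A uA.
exists [set i : 'I_n.-1 | <<(copid_mx i.+1 : 'M_n.-1.+1) *m A>>%MS \in c], h.
apply/setP => U; apply/imsetP/idP => [[i iS ->]|Uc].
  by rewrite inE in iS.
have /and3P[/andP[/eqP cU sU] U0 U1] := cb U Uc.
have rU0 : (0 < \rank U)%N by rewrite lt0n mxrank_eq0.
have rU1 : (\rank U < n.-1.+1)%N by have := rank_ltmx U1; rewrite mxrank1.
(* By [flag_rank], a member of rank r occupies position [n.-1 - r]. *)
have lti : (n.-1 - \rank U < n.-1)%N by lia.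
have EU : <<(copid_mx (n.-1 - \rank U).+1 : 'M_n.-1.+1) *m A>>%MS = U.
  by apply: genmx_fix cU _; rewrite -subSn //; apply: bA.
by exists (Ordinal lti); rewrite ?inE EU.
Qed.

(** The character induced from 1 counts at [g] the [g]-stable flags of its type. A flag with [#|c|]
    members comes from a J of size n - 1 - [#|c|], so the alternating sum is (-1)^(n-1) times the
    chain sum. *)
Lemma steinbergE (n : nat) (F : finFieldType) (g : {'GL_n[F]}) : (0 < n)%N ->
  steinberg n F g = ratr ((-1) ^+ n * moebius (GLval g) 1%:M).
Proof.
move=> n0; rewrite /steinberg sum_cfunE.
pose good (c : {set 'M[F]_n.-1.+1}) := chain (sub_lt (GLval g)) c && below (sub_lt (GLval g)) c 1%:M.
pose isflag (S : {set 'I_n.-1}) (c : {set 'M[F]_n.-1.+1}) := [exists h : {'GL_n[F]}, flag S h == c].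
have ind S : 'Ind['GL_n[F], standard_parabolic F S] 1 g =
    \sum_(c | good c && isflag S c) 1.
  rewrite cfIndE ?subsetT //=.
  transitivity (#|standard_parabolic F S|%:R^-1 * \sum_(h | good (flag S h)) 1 : algC).
    congr (_ * _); rewrite (reindex_inj invg_inj) /= big_mkcond [RHS]big_mkcond /=.
    apply: eq_bigr => h _; rewrite groupV inE cfun1E parabolic_stable.
    rewrite /good flag_good -mulrb; congr (_%:R); congr (nat_of_bool _).
    apply: eq_forallb => i; congr (_ ==> _).
    rewrite GLval_conjV !mulmxA.
    have fh : row_free (invmx (GLval h)) by rewrite row_free_unit unitmx_inv GL_unitmx.
    by rewrite -[RHS](submxMfree _ _ fh) mulmxK ?GL_unitmx.
  rewrite (partition_big (flag S) (fun c => good c && isflag S c)) /=; last first.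
    by move=> h ->; apply/existsP; exists h.
  rewrite mulr_sumr; apply: eq_bigr => c /andP[gc /existsP[k /eqP kc]].
  rewrite (eq_bigl [in [set h | flag S h == flag S k]]) => [|h]; last first.
    by rewrite inE kc; case: eqP => [->|]; rewrite ?gc ?andbF.
  by rewrite sumr_const flag_fiber card_rcoset mulVf // pnatr_eq0 -lt0n cardG_gt0.
rewrite (reindex_inj (inv_inj (@setCK _))) /=.
transitivity (\sum_(S : {set 'I_n.-1}) \sum_(c | good c && isflag S c)
    (-1) ^+ n.-1 * (-1) ^+ #|c| : algC).
  apply: eq_bigr => S _; rewrite cfunE setCK ind mulr_sumr; apply: eq_bigr => c.
  case/andP=> _ /existsP[h /eqP<-]; rewrite card_flag mulr1.
  have -> : (-1) ^+ n.-1 = (-1) ^+ #|S| * (-1) ^+ #|~: S| :> algC.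
    by rewrite -exprD cardsC card_ord.
  by rewrite mulrAC -expr2 sqrr_sign mul1r.
rewrite (exchange_big_dep good) /=; last by move=> S c _ /andP[].
have E2 : (-1) ^+ n = - (-1) ^+ n.-1 :> rat.
  by rewrite -[in LHS](prednK n0) exprS mulN1r.
rewrite /moebius -mxrank_eq0 mxrank1 /= mulrN -mulNr E2 opprK.
rewrite rmorphM rmorphXn rmorphN1 /= /chain_sum rmorph_sum mulr_sumr.
apply: eq_bigr => c gc.
have [S [h Sh]] : exists S, exists h : {'GL_n[F]}, flag S h = c.
  by case/andP: gc => /flag_exists H /H.
rewrite (big_pred1 S) => [|S']; first by rewrite rmorphXn rmorphN1.
rewrite gc /=; apply/existsP/eqP => [[k /eqP]|->].
  by rewrite -Sh => /flag_type_inj.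
by exists h; apply/eqP.
Qed.

(** * Matrices stabilizing an irreducible subspace *)

(** This is [companionmx p] with its size as a separate parameter, which lets it serve as a block of
    a matrix of size [m + e.+1]. *)
Definition companion (R : nzRingType) (e : nat) (p : {poly R}) : 'M[R]_e.+1 :=
  \matrix_(i, j) if i == ord_max then - p`_j else (i.+1 == j)%:R.

Lemma char_poly_companion (R : comNzRingType) (e : nat) (p : {poly R}) :
  p \is monic -> size p = e.+2 -> char_poly (companion e p) = p.
Proof.
move=> mp sp; have := companionmxK mp; rewrite /companionmx sp /= => {2}<-.
by congr char_poly; apply/matrixP => i j; rewrite !mxE.
Qed.

(** * Krylov matrices and intertwiners with a companion matrix *)

Definition krylov (F : fieldType) (d n : nat) (g : 'M[F]_n) (v : 'rV[F]_n) :
  'M[F]_(d, n) := \matrix_(i < d) iter i (mulmx^~ g) v.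

Lemma krylov_comb (F : fieldType) (d n : nat) (g : 'M[F]_n.+1) (v : 'rV[F]_n.+1)
    (a : 'rV[F]_d) :
  a *m krylov d g v = v *m horner_mx g (rVpoly a).
Proof.
rewrite mulmx_sum_row [rVpoly a]poly_def rmorph_sum /= mulmx_sumr.
apply: eq_bigr => i _; rewrite rowK valK /= linearZ /= rmorphXn /= horner_mx_X.
rewrite -scalemxAr; congr (_ *: _); elim: (val i) => [|k IH] /=.
  by rewrite expr0 mulmx1.
by rewrite IH exprSr mulmxA.
Qed.

(** A linear relation between the rows is a polynomial r of degree less than that of [p] with v r(g)
    = 0. A nonzero r would be coprime to [p], and Bezout would give v = 0. *)
Lemma krylov_free (F : fieldType) (n : nat) (p : {poly F}) (g : 'M[F]_n.+1)
    (v : 'rV[F]_n.+1) :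
  irreducible_poly p -> v *m horner_mx g p = 0 -> v != 0 ->
  row_free (krylov (size p).-1 g v).
Proof.
move=> [sp irr] vp v0; rewrite -kermx_eq0; apply/rowV0P => a /sub_kermxP.
rewrite krylov_comb; set r := rVpoly a => vr.
have [r0|r0] := eqVneq r 0; first by rewrite -[a]rVpolyK -/r r0 linear0.
case/eqP: v0; have : coprimep p r.
  rewrite coprimep_sym /coprimep; apply: contraTT r0 => /irr.
  move=> /(_ (dvdp_gcdr _ _)) pg; have pr : p %| r.
    by rewrite -(eqp_dvdl _ pg) dvdp_gcdl.
  apply: contraTN pr => r0; rewrite gtNdvdp //.
  by rewrite (leq_ltn_trans (size_poly _ _)) // prednK // (ltn_trans _ sp).
move=> /Bezout_eq1_coprimepP[[u w] /= /(congr1 (fun r => v *m horner_mx g r))].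
rewrite rmorphD rmorph1 mulmx1 => <-; rewrite mulrC [w * r]mulrC !rmorphM /=.
by rewrite mulmxDr !mulmxA vr vp !mul0mx addr0.
Qed.

Lemma krylov_sub (F : fieldType) (d m n : nat) (g : 'M[F]_n) (v : 'rV[F]_n)
    (U : 'M[F]_(m, n)) :
  stablemx U g -> (v <= U)%MS -> (krylov d g v <= U)%MS.
Proof.
move=> sU vU; apply/row_subP => i; rewrite rowK; elim: (val i) => //= k IH.
exact: submx_trans (submxMr _ IH) sU.
Qed.

(** By Cayley-Hamilton and [krylov_free], every nonzero vector is cyclic for [g]. *)
Lemma irreducible_stable (F : fieldType) (m n : nat) (g : 'M[F]_n) (U : 'M[F]_(m, n)) :
  irreducible_poly (char_poly g) -> stablemx U g -> U != 0 -> row_full U.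
Proof.
case: n g U => [|n] g U irr sU /rowV0Pn[v vU v0].
  by rewrite thinmx0 eqxx in v0.
have vp : v *m horner_mx g (char_poly g) = 0 by rewrite Cayley_Hamilton mulmx0.
have := krylov_free irr vp v0; rewrite size_char_poly /=.
rewrite row_free_unit -row_full_unit -!sub1mx => /submx_trans; apply.
exact: krylov_sub.
Qed.

Lemma krylov_intertwines (F : fieldType) (e n : nat) (p : {poly F}) (g : 'M[F]_n)
    (v : 'rV[F]_n) :
  p \is monic -> size p = e.+2 -> (v <= kermxpoly g p)%MS ->
  krylov e.+1 g v *m g = companion e p *m krylov e.+1 g v.
Proof.
move=> mp sp; case: n g v => [|n] g v.
  by move=> _; apply/matrixP => i [].
move=> /sub_kermxP vp; apply/row_matrixP => i.
rewrite !row_mul [row i (krylov _ _ _)]rowK /=.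
have [->|ni] := eqVneq i ord_max.
  have -> : row ord_max (companion e p) = - poly_rV (p - 'X^(e.+1)).
    apply/rowP => j; rewrite !mxE eqxx coefB coefXn.
    by rewrite (ltn_eqF (ltn_ord j)) subr0.
  rewrite mulNmx krylov_comb poly_rV_K; last first.
    apply/leq_sizeP => j ej; rewrite coefB coefXn.
    have [->|nj] := eqVneq j e.+1.
      by move/monicP: mp; rewrite /lead_coef sp /= => ->; rewrite subrr.
    by rewrite nth_default ?subr0 // sp ltn_neqAle eq_sym nj.
  rewrite rmorphB /= mulmxBr vp sub0r opprK rmorphXn /= horner_mx_X /=.
  rewrite -[iter _ _ _ *m g]/(iter e.+1 (mulmx^~ g) v).
  elim: (e.+1) => [|k IH] /=; first by rewrite expr0 mulmx1.
  by rewrite IH exprSr mulmxA.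
have lti : (i.+1 < e.+1)%N.
  by rewrite ltn_neqAle ltn_ord andbT; apply: contra ni => /eqP[E]; apply/eqP/val_inj.
have -> : row i (companion e p) = delta_mx 0 (Ordinal lti).
  by apply/rowP => j; rewrite !mxE (negbTE ni) eqxx /= eq_sym.
by rewrite -rowE rowK.
Qed.

Lemma horner_intertwines (F : fieldType) (m n : nat) (A : 'M[F]_(m.+1, n.+1))
    (g : 'M[F]_n.+1) (c : 'M[F]_m.+1) (p : {poly F}) :
  A *m g = c *m A -> A *m horner_mx g p = horner_mx c p *m A.
Proof.
move=> E; elim/poly_ind: p => [|p a IH]; first by rewrite !rmorph0 mulmx0 mul0mx.
rewrite !rmorphD !rmorphM /= !horner_mx_X !horner_mx_C mulmxDr mulmxDl mulmxA IH.
by rewrite -!mulmxA E mul_scalar_mx mul_mx_scalar.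
Qed.

Lemma intertwines_krylov (F : fieldType) (e n : nat) (p : {poly F}) (g : 'M[F]_n)
    (A : 'M[F]_(e.+1, n)) :
  p \is monic -> size p = e.+2 -> A *m g = companion e p *m A ->
  (row 0 A <= kermxpoly g p)%MS /\ A = krylov e.+1 g (row 0 A).
Proof.
case: n g A => [|n] g A mp sp E.
  by split; [rewrite [row 0 A]thinmx0 sub0mx | apply/matrixP => i []].
split.
  apply/sub_kermxP; rewrite -row_mul (horner_intertwines _ E).
  by rewrite -[p in horner_mx _ p](char_poly_companion mp sp) Cayley_Hamilton mul0mx row0.
apply/row_matrixP => -[i lti]; rewrite rowK /=.
elim: i lti => [|i IH] lti /=; first by congr row; apply: val_inj.
have lti' := ltnW lti; rewrite -(IH lti') -row_mul E row_mul.
have -> : row (Ordinal lti') (companion e p) = delta_mx 0 (Ordinal lti).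
  apply/rowP => j; rewrite !mxE.
  have -> : (Ordinal lti' == ord_max) = false by rewrite -val_eqE /= ltn_eqF.
  by rewrite eqxx /= eq_sym.
by rewrite -rowE.
Qed.

(** An intertwiner is the Krylov matrix of its first row, which may be any vector killed by p(g). *)
Lemma card_intertwines (F : finFieldType) (e n : nat) (p : {poly F}) (g : 'M[F]_n) :
  p \is monic -> size p = e.+2 ->
  #|[set A : 'M[F]_(e.+1, n) | A *m g == companion e p *m A]| =
  (#|F| ^ \rank (kermxpoly g p))%N.
Proof.
move=> mp sp; rewrite -card_rowg.
rewrite -(card_in_imset (f := krylov e.+1 g)) => [|v w _ _ E]; last first.
  by have := congr1 (row 0) E; rewrite !rowK.
apply: eq_card => A; rewrite inE; apply/eqP/imsetP => [E|[v vK ->]].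
  have [h1 h2] := intertwines_krylov mp sp E.
  by exists (row 0 A) => //; rewrite inE.
by apply: krylov_intertwines; rewrite inE in vK.
Qed.

(** Schur's lemma: the kernel of [A] is stable under [c], which acts irreducibly. *)
Lemma intertwines_free (F : fieldType) (d n : nat) (g : 'M[F]_n) (c : 'M[F]_d)
    (A : 'M[F]_(d, n)) :
  irreducible_poly (char_poly c) -> A *m g = c *m A -> A != 0 -> row_free A.
Proof.
move=> irr E A0; rewrite -kermx_eq0; apply: contraNT A0 => k0.
have sk : stablemx (kermx A) c.
  by apply/sub_kermxP; rewrite -mulmxA -E mulmxA mulmx_ker mul0mx.
have := irreducible_stable irr sk k0.
rewrite -sub1mx => /sub_kermxP; rewrite mul1mx => ->; exact: eqxx.
Qed.

Lemma horner_mx_tr (R : comNzRingType) (n : nat) (g : 'M[R]_n.+1) (p : {poly R}) :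
  horner_mx g^T p = (horner_mx g p)^T.
Proof.
elim/poly_ind: p => [|p a IH]; first by rewrite !rmorph0 trmx0.
rewrite !rmorphD !rmorphM /= !horner_mx_X !horner_mx_C linearD /= tr_scalar_mx IH.
have -> : horner_mx g p * g = g * horner_mx g p.
  by rewrite -{2 3}[g]horner_mx_X -!rmorphM /= mulrC.
by rewrite trmx_mul.
Qed.

Lemma rank_kermxpoly_tr (F : fieldType) (n : nat) (g : 'M[F]_n) (p : {poly F}) :
  \rank (kermxpoly g^T p) = \rank (kermxpoly g p).
Proof.
case: n g => [|n] g; first by rewrite !thinmx0.
by rewrite !mxrank_ker horner_mx_tr mxrank_tr.
Qed.

Lemma char_poly_tr (R : comNzRingType) (n : nat) (g : 'M[R]_n) :
  char_poly g^T = char_poly g.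
Proof.
rewrite /char_poly -[in RHS]det_tr; congr (\det _).
by rewrite /char_poly_mx linearB /= tr_scalar_mx map_trmx.
Qed.

(** The Krylov matrix of the first basis vector under the transpose is a nonzero intertwiner, hence
    invertible by Schur's lemma. Its purpose is to reduce the count of column intertwiners to that
    of row intertwiners. *)
Lemma companion_tr_conj (F : fieldType) (e : nat) (p : {poly F}) :
  irreducible_poly p -> p \is monic -> size p = e.+2 ->
  exists2 M, M \in unitmx & M *m (companion e p)^T = companion e p *m M.
Proof.
move=> irr mp sp; pose v : 'rV[F]_e.+1 := delta_mx 0 0.
have E : krylov e.+1 (companion e p)^T v *m (companion e p)^T =
    companion e p *m krylov e.+1 (companion e p)^T v.
  apply: krylov_intertwines => //; apply/sub_kermxP.
  rewrite -[p in horner_mx _ p](char_poly_companion mp sp) -char_poly_tr.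
  by rewrite Cayley_Hamilton mulmx0.
exists (krylov e.+1 (companion e p)^T v) => //.
rewrite -row_free_unit; apply: (intertwines_free _ E).
  by rewrite char_poly_companion.
apply/eqP => /(congr1 (row 0)); rewrite rowK row0 /= => /rowP/(_ 0).
by rewrite !mxE !eqxx => /eqP; rewrite oner_eq0.
Qed.

Lemma card_intertwines_col (F : finFieldType) (e n : nat) (p : {poly F}) (g : 'M[F]_n) :
  irreducible_poly p -> p \is monic -> size p = e.+2 ->
  #|[set X : 'M[F]_(n, e.+1) | g *m X == X *m companion e p]| =
  (#|F| ^ \rank (kermxpoly g p))%N.
Proof.
move=> irr mp sp; rewrite -rank_kermxpoly_tr -(card_intertwines _ mp sp).
have [M uM ME] := companion_tr_conj irr mp sp.
have inj : injective (fun X : 'M[F]_(n, e.+1) => M *m X^T).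
  by move=> X Y /(congr1 (mulmx (invmx M))); rewrite !mulKmx // => /trmx_inj.
rewrite -(card_imset _ inj); apply: eq_card => A; rewrite !inE.
apply/imsetP/eqP => [[X]|E].
  rewrite inE => /eqP E ->; rewrite -mulmxA -trmx_mul E trmx_mul !mulmxA.
  by rewrite ME.
exists (invmx M *m A)^T; last by rewrite trmxK mulKVmx.
rewrite inE; apply/eqP/trmx_inj; rewrite !trmx_mul !trmxK -mulmxA E.
apply: (can_inj (mulKmx uM)); rewrite mulKVmx // !mulmxA ME -!mulmxA mulKVmx //.
Qed.

(** Weisner's theorem for L, the span of the last [d] coordinates, which is simple since
    [char_poly c] is irreducible. A stable U with U + L = V is V or a complement of L. The
    complements are the row spaces of [row_mx 1%:M X]; such a space is stable exactly when h X = B +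
    X c, and [g] then acts on it as [h]. *)
Lemma moebius_block (F : finFieldType) (m d : nat) (h : 'M[F]_m) (B : 'M[F]_(m, d))
    (c : 'M[F]_d) :
  (0 < d)%N -> irreducible_poly (char_poly c) ->
  moebius (block_mx h B 0 c) 1%:M =
  - #|[set X | h *m X == B + X *m c]|%:R * moebius h 1%:M.
Proof.
move=> d0 irr; set g := block_mx h B 0 c.
pose L0 : 'M[F]_(d, m + d) := row_mx 0 1%:M.
have rL : row_free L0.
  by apply/row_freeP; exists (col_mx 0 1%:M); rewrite mul_row_col mul0mx add0r mulmx1.
have L0g : L0 *m g = c *m L0.
  by rewrite mul_row_block mul_mx_row !mul0mx !mul1mx mulmx0 mulmx1 !add0r.
have sL : stsub g <<L0>>%MS by rewrite stsub_gen L0g submxMl.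
have Ln0 : <<L0>>%MS != 0.
  by rewrite -mxrank_eq0 genmxE (eqP rL) -lt0n.
have n0 : (1%:M : 'M[F]_(m + d)) != 0.
  by rewrite -mxrank_eq0 mxrank1 -lt0n addn_gt0 d0 orbT.
have := moebius_weisner sL Ln0 (stsub1 g) (submx1 _).
rewrite (bigD1 1%:M) /=; last first.
  rewrite stsub1 /=; apply/eqP; apply: genmx_fix; first exact: genmx1.
  by apply/eqmxP; rewrite submx1 addsmxSl.
move/eqP; rewrite addr_eq0 => /eqP->; rewrite mulNr; congr (- _).
pose M X : 'M[F]_(m, m + d) := row_mx 1%:M X.
have fM X : row_free (M X).
  by apply/row_freeP; exists (col_mx 1%:M 0); rewrite mul_row_col mulmx0 addr0 mulmx1.
have Mg X : M X *m g = row_mx h (B + X *m c).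
  by rewrite mul_row_block !mul1mx mulmx0 addr0.
have Minj X Y : (M X <= M Y)%MS -> X = Y.
  case/submxP=> D; rewrite mul_mx_row mulmx1 => /eq_row_mx[<-].
  by rewrite mul1mx.
transitivity (\sum_(X in [set X | h *m X == B + X *m c]) moebius g <<M X>>%MS).
  rewrite -(big_imset (h := fun X => <<M X>>%MS) (moebius g)) /=; last first.
    by move=> X Y _ _ /genmxP/andP[/Minj].
  apply: eq_bigl => U; apply/idP/imsetP; last first.
    case=> X; rewrite inE => /eqP EX ->; rewrite stsub_gen Mg -EX.
    rewrite -[h in row_mx h _]mulmx1 -mul_mx_row submxMl /=; apply/andP; split.
      apply/eqP; apply: genmx_fix; first exact: genmx1.
      apply/eqmxP; rewrite submx1 scalar_mx_block block_mxEv col_mx_sub.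
      have -> : row_mx 1%:M 0 = M X - X *m L0.
        rewrite mul_mx_row mulmx0 mulmx1 opp_row_mx add_row_mx oppr0 addr0.
        by rewrite subrr.
      have HX : (M X <= <<M X>> + <<L0>>)%MS by rewrite -(genmxE (M X)) addsmxSl.
      have HL : (L0 <= <<M X>> + <<L0>>)%MS by rewrite -(genmxE L0) addsmxSr.
      by rewrite HL addmx_sub // eqmx_opp mulmx_sub.
    apply/eqP => /(congr1 (fun A => \rank A)); rewrite genmxE (eqP (fM X)) mxrank1.
    by move/eqP; rewrite -{1}[m]addn0 eqn_add2l eq_sym -leqn0 leqNgt d0.
  case/andP=> /andP[/andP[/eqP cU sU] /eqP UL] U1.
  have full : (1%:M <= U + L0)%MS.
    by rewrite -UL genmxE addsmxS // genmxE.
  (* [K] is the intersection of U and L in the coordinates of L. It is [c]-stable, hence zero unless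
     U contains L, in which case U is the whole space. *)
  pose K := (U :&: L0)%MS *m col_mx 0 1%:M.
  have KL0 : (K *m L0 :=: U :&: L0)%MS.
    have /submxP[D E] : (U :&: L0 <= L0)%MS by exact: capmxSr.
    have LK : L0 *m col_mx 0 1%:M = 1%:M by rewrite mul_row_col mul0mx add0r mulmx1.
    by rewrite /K E -(mulmxA D) LK mulmx1.
  have sK : stablemx K c.
    rewrite -(submxMfree _ _ rL) KL0 -mulmxA -L0g mulmxA (eqmxMr _ KL0).
    rewrite sub_capmx (submx_trans (submxMr _ (capmxSl _ _))) //=.
    rewrite (submx_trans (submxMr _ (capmxSr _ _))) // L0g submxMl //.
  have K0 : K = 0.
    apply/eqP; apply: contraNT U1 => K0.
    have := irreducible_stable irr sK K0; rewrite -sub1mx => /(submxMr L0).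
    rewrite mul1mx KL0 sub_capmx => /andP[LU _]; apply/eqP.
    rewrite -cU; apply: genmx_fix; first exact: genmx1.
    apply/eqmxP; rewrite submx1; apply: submx_trans full _.
    by rewrite addsmx_sub submx_refl.
  have rU : \rank U = m.
    have := mxrank_sum_cap U L0; rewrite -KL0 K0 mul0mx mxrank0 addn0 (eqP rL).
    have -> : \rank (U + L0)%MS = (m + d)%N.
      by apply/eqP; rewrite -/(row_full _) -sub1mx.
    by move/eqP; rewrite eqn_add2r => /eqP.
  have /row_fullP[Q UQ] : row_full (lsubmx U).
    rewrite -sub1mx.
    have := submxMr (col_mx 1%:M 0) full.
    rewrite mul1mx addsmxMr mul_row_col mul0mx mulmx0 addr0 addsmx0.
    rewrite -{1}[U]hsubmxK mul_row_col mulmx1 mulmx0 addr0 => /(submx_trans _); apply.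
    by apply/submxP; exists (row_mx 1%:M 0); rewrite mul_row_col mulmx1 mulmx0 addr0.
  have MU : Q *m U = M (Q *m rsubmx U) by rewrite -{1}[U]hsubmxK mul_mx_row UQ.
  have EU : (M (Q *m rsubmx U) :=: U)%MS.
    apply/eqmxP; rewrite -MU submxMl /= -(geq_leqif (mxrank_leqif_sup (submxMl _ _))).
    by rewrite MU (eqP (fM _)) rU.
  exists (Q *m rsubmx U); last by apply/esym/genmx_fix.
  rewrite inE; have := sU; rewrite -(eqmx_stable g EU) Mg => /submxP[D].
  by rewrite mul_mx_row mulmx1 => /eq_row_mx[<- ->].
rewrite -sum1_card natr_sum mulr_suml; apply: eq_bigr => X; rewrite inE => /eqP EX.
have MX : M X *m g = h *m M X by rewrite Mg mul_mx_row mulmx1 EX.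
by rewrite mul1r -(moebius_embed (fM X) MX (stsub1 h)) mul1mx.
Qed.

Lemma char_poly_block (R : comNzRingType) (m d : nat) (A : 'M[R]_m) (B : 'M[R]_(m, d))
    (C : 'M[R]_d) :
  char_poly (block_mx A B 0 C) = char_poly A * char_poly C.
Proof.
rewrite /char_poly /char_poly_mx scalar_mx_block map_block_mx opp_block_mx.
by rewrite add_block_mx map_mx0 oppr0 addr0 det_ublock.
Qed.

Lemma char_poly_conj (F : fieldType) (n : nat) (h g g' : 'M[F]_n) :
  h \in unitmx -> g' *m h = h *m g -> char_poly g' = char_poly g.
Proof.
move=> uh E; pose H := map_mx (@polyC F) h.
have H0 : \det H != 0 by rewrite det_map_mx polyC_eq0 -unitfE -unitmxE.
apply: (mulIf H0); rewrite /char_poly [RHS]mulrC -!det_mulmx; congr (\det _).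
by rewrite /char_poly_mx mulmxBl mulmxBr mul_scalar_mx mul_mx_scalar -!map_mxM E.
Qed.

Lemma moebius_conj (F : finFieldType) (n : nat) (h g g' : 'M[F]_n) :
  h \in unitmx -> g' *m h = h *m g -> moebius g' 1%:M = moebius g 1%:M.
Proof.
move=> uh E; have fh : row_free h by rewrite row_free_unit.
rewrite -(moebius_embed fh (esym E) (stsub1 g')) mul1mx; congr (moebius g _).
by apply: genmx_fix (genmx1 _ _) _; apply/eqmxP; rewrite submx1 sub1mx row_full_unit.
Qed.

Lemma rank_kermxpoly_conj (F : fieldType) (n : nat) (h g g' : 'M[F]_n) (p : {poly F}) :
  h \in unitmx -> g' *m h = h *m g ->
  \rank (kermxpoly g' p) = \rank (kermxpoly g p).
Proof.
case: n h g g' => [|n] h g g' uh E; first by rewrite !thinmx0.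
rewrite !mxrank_ker; congr (_ - _)%N.
rewrite -(mxrankMfree (horner_mx g' p) (_ : row_free h)) ?row_free_unit //.
by rewrite -(horner_intertwines p (esym E)) eqmxMfull ?row_full_unit.
Qed.

Lemma kermxpoly_coprime_char (F : fieldType) (n : nat) (g : 'M[F]_n) (p : {poly F}) :
  coprimep p (char_poly g) -> \rank (kermxpoly g p) = 0.
Proof.
case: n g => [|n] g cop; first by rewrite thinmx0 mxrank0.
apply/eqP; rewrite mxrank_eq0; apply/rowV0P => v /sub_kermxP vp.
have [[u w] /= /(congr1 (fun r => v *m horner_mx g r))] := Bezout_eq1_coprimepP _ _ cop.
rewrite rmorphD rmorph1 mulmx1 => <-.
by rewrite mulrC !rmorphM /= Cayley_Hamilton mulr0 addr0 mulmxA vp mul0mx.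
Qed.

(* Over the field obtained by adjoining a root of p, the matrix g acquires that
   root as an eigenvalue, so that p(g) is singular. *)
Lemma kermxpoly_dvd_char (F : fieldType) (n : nat) (g : 'M[F]_n) (p : {poly F}) :
  irreducible_poly p -> p %| char_poly g -> kermxpoly g p != 0.
Proof.
move=> irr pg; case: n g pg => [|n] g pg.
  case: irr => sp _; have := dvdp_leq (monic_neq0 (char_poly_monic g)) pg.
  by rewrite size_char_poly leqNgt sp.
have [L _ [z rz _]] := irredp_FAdjoin irr.
rewrite kermx_eq0 row_free_unit -(map_unitmx (in_alg L)) map_horner_mx.
have : root (char_poly (map_mx (in_alg L) g)) z.
  by rewrite -map_char_poly -(divpK pg) rmorphM rootM rz orbT.
rewrite -eigenvalue_root_char => /eigenvalueP[v vg v0].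
apply: contra v0 => u; rewrite -(mulmxK u v).
have -> : v *m horner_mx (map_mx (in_alg L) g) (map_poly (in_alg L) p) =
   (map_poly (in_alg L) p).[z] *: v.
  elim/poly_ind: (map_poly _ p) => [|r a IH].
    by rewrite rmorph0 mulmx0 horner0 scale0r.
  rewrite rmorphD rmorphM /= horner_mx_X horner_mx_C mulmxDr mulmxA IH.
  by rewrite -scalemxAl vg scalerA mul_mx_scalar hornerMXaddC scalerDl.
by rewrite (rootP rz) scale0r mul0mx.
Qed.

Lemma complete_row_free (F : fieldType) (m d : nat) (A : 'M[F]_(d, m + d)) :
  row_free A -> exists2 h : 'M[F]_(m + d), h \in unitmx & dsubmx h = A.
Proof.
move=> fA; have rA : \rank A^C = m by rewrite mxrank_compl (eqP fA) addnK.
exists (col_mx (castmx (rA, erefl) (row_base A^C)%MS) A); last by rewrite col_mxKd.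
rewrite -row_full_unit -sub1mx -addsmxE.
have E : (castmx (rA, erefl) (row_base A^C)%MS :=: A^C)%MS.
  by apply: eqmx_trans (eqmx_cast _ _) (eq_row_base _).
by rewrite (adds_eqmx E (eqmx_refl A)) addsmxC sub1mx addsmx_compl_full.
Qed.

Lemma intertwines_conj (F : fieldType) (m d : nat) (g h : 'M[F]_(m + d)) (c : 'M[F]_d) :
  h \in unitmx -> dsubmx h *m g = c *m dsubmx h ->
  dsubmx (h *m g *m invmx h) = row_mx 0 c.
Proof.
move=> uh E; rewrite -[h in dsubmx (h *m _ *m _)]vsubmxK !mul_col_mx col_mxKd E.
have : dsubmx (h *m invmx h) = row_mx 0 1%:M.
  by rewrite mulmxV // scalar_mx_block block_mxEv col_mxKd.
rewrite -{1}[h]vsubmxK mul_col_mx col_mxKd -mulmxA => ->.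
by rewrite mul_mx_row mulmx0 mulmx1.
Qed.

(** The solution [X] conjugates the matrix to the block diagonal one. The ranks are then compared
    through the numbers of intertwiners, which are powers of [#|F|] and multiply over diagonal
    blocks. *)
Lemma rank_kermxpoly_block (F : finFieldType) (m e : nat) (p : {poly F}) (h : 'M[F]_m)
    (B X : 'M[F]_(m, e.+1)) :
  p \is monic -> size p = e.+2 -> h *m X = B + X *m companion e p ->
  \rank (kermxpoly (block_mx h B 0 (companion e p)) p) =
  (\rank (kermxpoly h p) + e.+1)%N.
Proof.
move=> mp sp EX; set c := companion e p.
have rc : \rank (kermxpoly c p) = e.+1.
  by rewrite /kermxpoly -[p in horner_mx _ p](char_poly_companion mp sp) Cayley_Hamilton kermx0 mxrank1.
have uX : (block_mx 1%:M X 0 1%:M : 'M[F]_(m + e.+1)) \in unitmx.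
  by rewrite unitmxE det_ublock !det1 mulr1 unitr1.
have E : block_mx h 0 0 c *m block_mx 1%:M X 0 1%:M = block_mx 1%:M X 0 1%:M *m block_mx h B 0 c.
  rewrite !mulmx_block ?mulmx0 ?mul0mx ?mulmx1 ?mul1mx ?addr0 ?add0r.
  by rewrite EX.
rewrite -(rank_kermxpoly_conj p uX E).
transitivity (\rank (kermxpoly h p) + \rank (kermxpoly c p))%N; last by rewrite rc.
apply: (expnI (finRing_gt1 F)); rewrite expnD -!(card_intertwines _ mp sp).
pose f (A : 'M[F]_(e.+1, m + e.+1)) := (lsubmx A, rsubmx A).
have f_inj : injective f.
  by move=> A A' [E1 E2]; rewrite -[A]hsubmxK E1 E2 hsubmxK.
rewrite -cardsX -(card_imset _ f_inj).
apply: eq_card => -[A1 A2]; apply/imsetP/setXP => [[A]|[]]; rewrite !inE /=.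
  rewrite -{1 2}[A]hsubmxK mul_row_block !mulmx0 addr0 add0r mul_mx_row.
  by move=> /eqP/eq_row_mx[E1 E2] [-> ->]; rewrite E1 E2.
move=> /eqP E1 /eqP E2; exists (row_mx A1 A2); last by rewrite /f row_mxKl row_mxKr.
by rewrite inE mul_row_block !mulmx0 addr0 add0r mul_mx_row E1 E2.
Qed.

(** Since [p] divides the characteristic polynomial, some nonzero [v] is killed by p(g); a basis
    ending with the Krylov rows of [v] has the required form. *)
Lemma intertwiner_block (F : finFieldType) (m e : nat) (p : {poly F})
    (g : 'M[F]_(m + e.+1)) :
  irreducible_poly p -> p \is monic -> size p = e.+2 -> p %| char_poly g ->
  exists h, exists2 k : 'M[F]_m, h \in unitmx &
    exists B, h *m g = block_mx k B 0 (companion e p) *m h.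
Proof.
move=> irr mp sp /(kermxpoly_dvd_char irr)/rowV0Pn[v vK v0].
have E := krylov_intertwines mp sp vK.
have fA : row_free (krylov e.+1 g v).
  apply: (intertwines_free _ E); first by rewrite char_poly_companion.
  by apply: contraNneq v0 => /(congr1 (row 0)); rewrite rowK row0 /= => ->.
have [h uh Eh] := complete_row_free fA.
have := intertwines_conj uh; rewrite Eh => /(_ _ _ E) D.
exists h, (ulsubmx (h *m g *m invmx h)) => //; exists (ursubmx (h *m g *m invmx h)).
have <- : h *m g *m invmx h = block_mx (ulsubmx (h *m g *m invmx h))
    (ursubmx (h *m g *m invmx h)) 0 (companion e p).
  by rewrite -[LHS]submxK -[dlsubmx _]/(lsubmx (dsubmx _)) -[drsubmx _]/(rsubmx (dsubmx _)) D row_mxKl row_mxKr.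
by rewrite mulmxKV.
Qed.

(* A nonzero Moebius number forces g to be semisimple. *)
Lemma rank_kermxpoly_moebius (F : finFieldType) (e : nat) (p : {poly F})
    (n k : nat) (g : 'M[F]_n) (f : {poly F}) :
  irreducible_poly p -> p \is monic -> size p = e.+2 -> coprimep p f ->
  char_poly g = p ^+ k * f -> moebius g 1%:M != 0 ->
  \rank (kermxpoly g p) = (k * e.+1)%N.
Proof.
move=> irr mp sp cpf; elim: k n g => [|k IH] n g Eg mug.
  by rewrite mul0n kermxpoly_coprime_char // Eg mul1r.
have pg : p %| char_poly g by rewrite Eg exprS -mulrA dvdp_mulIl.
have [m En] : exists m, n = (m + e.+1)%N.
  exists (n - e.+1)%N; rewrite subnK //.
  have := dvdp_leq (monic_neq0 (char_poly_monic g)) pg.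
  by rewrite size_char_poly sp.
subst n; have [h [h2 uh [B EB]]] := intertwiner_block irr mp sp pg.
have := moebius_conj uh (esym EB); rewrite moebius_block ?char_poly_companion //.
move=> mu_eq; rewrite -mu_eq in mug.
(* Without a solution [X], [moebius_block] would make the Moebius number zero; so the extension
   splits and [p] loses one exponent. *)
have [c0|/set0Pn[X]] := eqVneq [set X | h2 *m X == B + X *m companion e p] set0.
  by rewrite c0 cards0 oppr0 mul0r eqxx in mug.
rewrite inE => /eqP EX.
rewrite -(rank_kermxpoly_conj p uh (esym EB)) (rank_kermxpoly_block mp sp EX).
rewrite (IH _ h2) ?mulSnr //; last by apply: contraNneq mug => ->; rewrite mulr0.
have := char_poly_conj uh (esym EB).
rewrite char_poly_block char_poly_companion // Eg exprSr mulrAC.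
by move/(mulIf (monic_neq0 mp)).
Qed.

(** * Double counting of intertwiners *)

Definition card_unitmx (F : finFieldType) (n : nat) : nat :=
  #|[set h : 'M[F]_n | h \in unitmx]|.

Lemma card_unitmx_gt0 (F : finFieldType) (n : nat) : (0 < card_unitmx F n)%N.
Proof. by apply/card_gt0P; exists 1%:M; rewrite inE unitmx1. Qed.

(** Dividing by one completion [k] on the right reduces to A = (0 1), where the completions are the
    block matrices with upper rows (a b), [a] invertible and [b] arbitrary. *)
Lemma card_complete (F : finFieldType) (m d : nat) (A : 'M[F]_(d, m + d)) :
  row_free A ->
  #|[set h | (h \in unitmx) && (dsubmx h == A)]| =
  (card_unitmx F m * #|F| ^ (m * d))%N.
Proof.
move=> fA; have [k uk Ek] := complete_row_free fA.
transitivity #|[set h : 'M[F]_(m + d) | (h \in unitmx) && (dsubmx h == row_mx 0 1%:M)]|.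
  rewrite -(card_imset _ (can_inj (mulmxKV uk))); apply: eq_card => h.
  rewrite !inE; apply/imsetP/andP => [[l]|[uh /eqP Eh]].
    rewrite inE => /andP[ul /eqP El] ->; rewrite unitmx_mul ul unitmx_inv uk.
    split=> //; rewrite -[l]vsubmxK mul_col_mx col_mxKd El -Ek.
    have : dsubmx (k *m invmx k) = row_mx 0 1%:M.
      by rewrite mulmxV // scalar_mx_block block_mxEv col_mxKd.
    by rewrite -{1}[k]vsubmxK mul_col_mx col_mxKd => ->.
  exists (h *m k); last by rewrite mulmxK.
  rewrite inE unitmx_mul uh uk /= -[h]vsubmxK mul_col_mx col_mxKd Eh.
  by rewrite -{1}[k]vsubmxK mul_row_col mul0mx mul1mx add0r Ek.
rewrite -card_mx -cardsT /card_unitmx -cardsX.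
pose f (x : 'M[F]_m * 'M[F]_(m, d)) := block_mx x.1 x.2 0 1%:M.
have f_inj : injective f.
  by move=> [a b] [a' b'] /eq_block_mx[/= -> -> _ _].
rewrite -(card_imset _ f_inj); apply: eq_card => h; rewrite inE.
apply/andP/imsetP => [[uh /eqP Eh]|[[a b]]].
  have E : h = f (ulsubmx h, ursubmx h).
    rewrite -[LHS]submxK /f /= -[dlsubmx _]/(lsubmx (dsubmx _)).
    by rewrite -[drsubmx _]/(rsubmx (dsubmx _)) Eh row_mxKl row_mxKr.
  exists (ulsubmx h, ursubmx h) => //; rewrite !inE /= andbT.
  by move: uh; rewrite {1}E /f unitmxE det_ublock det1 mulr1.
rewrite !inE /= andbT => ua ->; rewrite unitmxE det_ublock det1 mulr1.
by rewrite /f block_mxEv col_mxKd eqxx.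
Qed.

(* Both sides count the triples (g, A, h) where A <> 0 satisfies A g = c A and the
   last rows of the invertible matrix h are those of A. *)
Lemma sum_intertwines (F : finFieldType) (m d : nat) (c : 'M[F]_d)
    (phi : 'M[F]_(m + d) -> rat) :
  (0 < d)%N -> irreducible_poly (char_poly c) ->
  (forall h g g', h \in unitmx -> g' *m h = h *m g -> phi g' = phi g) ->
  \sum_g phi g * (#|[set A | A *m g == c *m A]|%:R - 1) *
    (card_unitmx F m * #|F| ^ (m * d))%N%:R =
  (card_unitmx F (m + d))%:R * \sum_h \sum_B phi (block_mx h B 0 c).
Proof.
move=> d0 irr conj_phi.
transitivity (\sum_g \sum_(h | (h \in unitmx) && (dsubmx h *m g == c *m dsubmx h)) phi g).
  apply: eq_bigr => g _; rewrite -mulrA sumr_const -[RHS]mulr_natr; congr (_ * _).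
  pose S := [set A | A *m g == c *m A] :\ 0.
  have -> : #|[set A | A *m g == c *m A]|%:R - 1 = #|S|%:R :> rat.
    rewrite (cardsD1 0 [set A | A *m g == c *m A]) inE mul0mx mulmx0 eqxx natrD.
    by rewrite addrC addKr.
  rewrite -natrM; congr (_%:R).
  rewrite -[RHS]sum1_card (partition_big dsubmx [in S]) /=; last first.
    move=> h /andP[uh E]; rewrite !inE E andbT; apply: contraTneq uh => h0.
    rewrite -row_free_unit -[h]vsubmxK h0 -kermx_eq0; apply/rowV0Pn.
    exists (row_mx 0 (delta_mx 0 (Ordinal d0))).
      by apply/sub_kermxP; rewrite mul_row_col mul0mx mulmx0 addr0.
    apply/eqP => /eqP; rewrite -row_mx0 => /eqP/eq_row_mx[_ /matrixP/(_ 0 (Ordinal d0))].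
    by rewrite !mxE !eqxx => /eqP; rewrite oner_eq0.
  rewrite (eq_bigr (fun _ => card_unitmx F m * #|F| ^ (m * d))%N) ?sum_nat_const // => A.
  rewrite !inE => /andP[A0 /eqP EA].
  rewrite -(card_complete (intertwines_free irr EA A0)) -[RHS]sum1_card.
  apply: eq_bigl => h; rewrite inE -andbA; congr (_ && _).
  by case: (dsubmx h =P A) => [->|_]; rewrite ?andbF // EA eqxx.
rewrite (exchange_big_dep (fun h => h \in unitmx)) /=; last by move=> g h _ /andP[].
(* Conjugation by [h] turns the condition on [g] into a condition on its last rows that no longer
   involves [h]. *)
transitivity (\sum_(h : 'M[F]_(m + d) | h \in unitmx)
   \sum_(g : 'M[F]_(m + d) | dsubmx g == row_mx 0 c) phi g).
  apply: eq_bigr => h uh; have uh' : invmx h \in unitmx by rewrite unitmx_inv.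
  have bij : bijective (fun g => h *m g *m invmx h).
    exists (fun g => invmx h *m g *m h) => g /=.
      by rewrite !mulmxA mulVmx // mul1mx mulmxKV.
    by rewrite !mulmxA mulmxV // mul1mx mulmxK.
  rewrite [RHS](reindex (fun g => h *m g *m invmx h)) /=; last exact: onW_bij.
  apply: eq_big => [g|g _]; last by apply/esym/(conj_phi h) => //; rewrite mulmxKV.
  rewrite uh /=; apply/eqP/eqP => [|E]; first exact: intertwines_conj.
  have : h *m g = (h *m g *m invmx h) *m h by rewrite mulmxKV.
  move/(congr1 dsubmx); rewrite -{1}[h]vsubmxK mul_col_mx col_mxKd => ->.
  rewrite -[h *m g *m invmx h]vsubmxK mul_col_mx col_mxKd E.
  by rewrite -{1}[h]vsubmxK mul_row_col mul0mx add0r.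
rewrite (eq_bigl [in [set h : 'M[F]_(m + d) | h \in unitmx]]) => [|h]; last by rewrite inE.
rewrite sumr_const [RHS]mulr_natl; congr (_ *+ _).
rewrite pair_big /= (reindex_onto (fun x : 'M[F]_m * 'M[F]_(m, d) => block_mx x.1 x.2 0 c)
  (fun g => (ulsubmx g, ursubmx g))) /=.
  apply: eq_bigl => -[h B]; rewrite /= block_mxKul block_mxKur eqxx andbT.
  by rewrite block_mxEv col_mxKd eqxx.
move=> g /eqP E; rewrite -[RHS]submxK -[dlsubmx _]/(lsubmx (dsubmx _)).
by rewrite -[drsubmx _]/(rsubmx (dsubmx _)) E row_mxKl row_mxKr.
Qed.

(** For each [B] the solutions are absent or form a coset of the homogeneous solutions, so two of
    the three factors may be replaced by the homogeneous count; and every [X] solves the equation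
    for exactly one [B]. *)
Lemma sum_affine_card (F : finFieldType) (m d : nat) (h : 'M[F]_m) (c : 'M[F]_d) :
  \sum_B #|[set X | h *m X == B + X *m c]|%:R ^+ 3 =
  #|[set X | h *m X == X *m c]|%:R ^+ 2 * (#|F| ^ (m * d))%:R :> rat.
Proof.
transitivity (\sum_(B : 'M[F]_(m, d)) #|[set X | h *m X == X *m c]|%:R ^+ 2 *
    #|[set X | h *m X == B + X *m c]|%:R : rat).
  apply: eq_bigr => B _; rewrite exprSr.
  have [->|/set0Pn[X0]] := eqVneq [set X | h *m X == B + X *m c] set0.
    by rewrite cards0 !mulr0.
  rewrite inE => /eqP E0; congr (_%:R ^+ 2 * _).
  rewrite -[RHS](card_imset _ (addIr X0)); apply: eq_card => X.
  rewrite inE; apply/eqP/imsetP => [E|[Y]].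
    exists (X - X0); rewrite ?subrK // inE mulmxBr mulmxBl E E0.
    by rewrite opprD addrACA subrr add0r.
  by rewrite inE => /eqP EY ->; rewrite mulmxDr mulmxDl EY E0 addrCA.
rewrite -mulr_sumr -natr_sum; congr (_ * _%:R).
transitivity (\sum_(B : 'M[F]_(m, d)) \sum_(X : 'M[F]_(m, d) | (h *m X == B + X *m c)%R) 1)%N.
  by apply: eq_bigr => B _; rewrite -sum1_card; apply: eq_bigl => X; rewrite inE.
rewrite (exchange_big_dep xpredT) //= -card_mx -sum1_card; apply: eq_bigr => X _.
rewrite (big_pred1 (h *m X - X *m c)) // => B.
by rewrite -subr_eq eq_sym.
Qed.

(** * Sums over a fixed characteristic polynomial *)

Definition char_sum (F : finFieldType) (n : nat) (f : {poly F}) : rat :=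
  (\sum_(g : 'M[F]_n | char_poly g == f) moebius g 1%:M ^+ 3) / (card_unitmx F n)%:R.

(** [sum_intertwines] for the cube of the Moebius number, restricted to one characteristic
    polynomial. Where that number is nonzero, semisimplicity at [p] fixes the number of
    intertwiners: Q^(k+1) on the left, and Q^k for the homogeneous equation on the right, which
    enters squared by [sum_affine_card]. *)
Lemma char_sum_step (F : finFieldType) (e m k : nat) (p f : {poly F}) :
  irreducible_poly p -> p \is monic -> size p = e.+2 -> coprimep p f ->
  char_sum (m + e.+1) (p ^+ k.+1 * f) * ((#|F| ^ e.+1)%:R ^+ k.+1 - 1) =
  - (#|F| ^ e.+1)%:R ^+ (2 * k) * char_sum m (p ^+ k * f).
Proof.
move=> irr mp sp cpf; set Q : rat := (#|F| ^ e.+1)%:R.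
have cK l : (card_unitmx F l)%:R != 0 :> rat by rewrite pnatr_eq0 -lt0n card_unitmx_gt0.
have cF : (#|F| ^ (m * e.+1))%:R != 0 :> rat.
  by rewrite pnatr_eq0 -lt0n expn_gt0 (ltnW (finRing_gt1 F)).
pose phi (g : 'M[F]_(m + e.+1)) : rat :=
  if char_poly g == p ^+ k.+1 * f then moebius g 1%:M ^+ 3 else 0.
have irrC : irreducible_poly (char_poly (companion e p)) by rewrite char_poly_companion.
have phi_conj h g g' : h \in unitmx -> g' *m h = h *m g -> phi g' = phi g.
  by move=> uh E; rewrite /phi (char_poly_conj uh E) (moebius_conj uh E).
have := sum_intertwines (ltn0Sn e) irrC phi_conj.
have -> : \sum_g phi g * (#|[set A | A *m g == companion e p *m A]|%:R - 1) *
    (card_unitmx F m * #|F| ^ (m * e.+1))%N%:R =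
  (\sum_g phi g) * ((Q ^+ k.+1 - 1) * (card_unitmx F m * #|F| ^ (m * e.+1))%N%:R).
  rewrite mulr_suml; apply: eq_bigr => g _; rewrite -mulrA /phi.
  case: eqP => [Eg|]; last by rewrite !mul0r.
  have [->|mug] := eqVneq (moebius g 1%:M) 0; first by rewrite expr0n !mul0r.
  rewrite card_intertwines // (rank_kermxpoly_moebius irr mp sp cpf Eg mug).
  by rewrite mulnC expnM natrX.
have -> : \sum_h \sum_B phi (block_mx h B 0 (companion e p)) =
   - (#|F| ^ (m * e.+1))%:R * Q ^+ (2 * k) *
   \sum_(h : 'M[F]_m | char_poly h == p ^+ k * f) moebius h 1%:M ^+ 3.
  rewrite mulr_sumr [RHS]big_mkcond /=; apply: eq_bigr => h _.
  have Ec B : (char_poly (block_mx h B 0 (companion e p)) == p ^+ k.+1 * f) =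
      (char_poly h == p ^+ k * f).
    rewrite char_poly_block char_poly_companion // exprSr mulrAC.
    by rewrite (inj_eq (mulIf (monic_neq0 mp))).
  under eq_bigr => B _ do rewrite /phi Ec moebius_block //.
  case: eqP => [Eh|]; last by rewrite big1.
  under eq_bigr => B _ do rewrite exprMn exprNn -signr_odd /= expr1 mulN1r.
  rewrite -mulr_suml sumrN sum_affine_card.
  have [->|muh] := eqVneq (moebius h 1%:M) 0; first by rewrite expr0n !mulr0.
  rewrite card_intertwines_col // (rank_kermxpoly_moebius irr mp sp cpf Eh muh).
  rewrite mulnC expnM natrX -exprM [(k * 2)%N]mulnC [_ ^+ (2 * k) * _]mulrC.
  by rewrite !mulNr.
rewrite /char_sum -!big_mkcond /= natrM => E.
apply: (mulfI (cK m)); apply: (mulfI (cK (m + e.+1)%N)); apply: (mulfI cF).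
have := cK m; have := cK (m + e.+1)%N.
move: E; set u := (card_unitmx F m)%:R; set w := (card_unitmx F (m + e.+1))%:R.
set s := \sum_(g | _) _; set t := \sum_(h | _) _; set c := (#|F| ^ (m * e.+1))%:R.
move=> E w0 u0.
transitivity (s * ((Q ^+ k.+1 - 1) * (u * c))); first by field.
rewrite E; by field.
Qed.

(* This is (-1)^k Q^(3 'C(k, 2)) / |GL_k(Q)|: up to sign, the cube of the Steinberg
   character of GL_k(Q) at 1, weighted by the order of the centralizer. *)
Definition local_weight (Q : rat) (k : nat) : rat :=
  \prod_(i < k) (- Q ^+ (2 * i) / (Q ^+ i.+1 - 1)).

Lemma char_sum_pow (F : finFieldType) (m k : nat) (p f : {poly F}) :
  irreducible_poly p -> p \is monic -> coprimep p f ->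
  char_sum (m + k * (size p).-1) (p ^+ k * f) =
  local_weight (#|F| ^ (size p).-1)%:R k * char_sum m f.
Proof.
move=> irr mp cpf; have [e sp] : exists e, size p = e.+2.
  by case: irr; case: (size p) => [|[|e]] // _ _; exists e.
rewrite sp /=; set Q : rat := _%:R.
have Q1 : 1 < Q.
  by rewrite ltr1n (leq_trans (finRing_gt1 F)) // -{1}[#|F|]expn1 leq_exp2l ?finRing_gt1.
elim: k => [|k IH]; first by rewrite mul0n addn0 expr0 mul1r /local_weight big_ord0 mul1r.
have Qk : Q ^+ k.+1 - 1 != 0 by rewrite subr_eq0 gt_eqF // exprn_egt1.
apply: (mulIf Qk); rewrite mulSnr addnA char_sum_step // IH.
by rewrite /local_weight big_ord_recr /= -/Q; field.
Qed.

Lemma char_sum0 (F : finFieldType) : char_sum 0 (1 : {poly F}) = 1.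
Proof.
rewrite /char_sum (eq_bigl xpredT) => [|g]; last by rewrite /char_poly det_mx00 eqxx.
rewrite (eq_bigr (fun _ => 1)) => [|g _]; last first.
  by rewrite /moebius [1%:M]flatmx0 eqxx expr1n.
rewrite sumr_const card_mx muln0 expn0 mulr1n.
have -> : card_unitmx F 0 = 1%N.
  rewrite /card_unitmx (eq_card (_ : _ =i xpredT)) ?card_mx ?muln0 // => g.
  by rewrite !inE unitmxE det_mx00 unitr1.
by rewrite divr1.
Qed.

Lemma coprimep_monic_irreducible (F : fieldType) (p r : {poly F}) :
  irreducible_poly p -> irreducible_poly r -> p \is monic -> r \is monic ->
  p != r -> coprimep p r.
Proof.
move=> [sp ip] [sr ir] mp mr; apply: contraNT; rewrite /coprimep => sg.
have := ip _ sg (dvdp_gcdl _ _); have := ir _ sg (dvdp_gcdr _ _).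
move=> gr gp; rewrite -eqp_monic //.
by apply: eqp_trans gr; rewrite eqp_sym.
Qed.

Lemma coprimep_prod_exp (F : fieldType) (I : eqType) (r : seq I) (p : {poly F})
    (P : I -> {poly F}) (m : I -> nat) :
  (forall j, j \in r -> coprimep p (P j)) -> coprimep p (\prod_(j <- r) P j ^+ m j).
Proof.
elim: r => [|j r IH] H; first by rewrite big_nil coprimep1.
rewrite big_cons coprimepMr coprimep_expr ?H ?mem_head // IH // => i ir.
by rewrite H // inE ir orbT.
Qed.

Lemma char_sum_prod (F : finFieldType) (I : eqType) (r : seq I)
    (P : I -> {poly F}) (m : I -> nat) :
  uniq r -> injective P -> (forall i, P i \is monic) ->
  (forall i, irreducible_poly (P i)) ->
  char_sum (\sum_(i <- r) m i * (size (P i)).-1) (\prod_(i <- r) P i ^+ m i) =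
  \prod_(i <- r) local_weight (#|F| ^ (size (P i)).-1)%:R (m i).
Proof.
move=> ur injP mP iP; elim: r ur => [|i r IH] /=.
  by rewrite !big_nil char_sum0.
case/andP=> nir ur; rewrite !big_cons addnC char_sum_pow ?IH //.
apply: coprimep_prod_exp => j jr; apply: coprimep_monic_irreducible => //.
by rewrite (inj_eq injP); apply: contraNneq nir => ->.
Qed.

(** * Euler products over irreducible polynomials *)

(** Coefficient vectors make the monic irreducible polynomials of degree at most [n] a finite type;
    these are all the possible factors of a polynomial of degree at most [n]. *)
Definition irr_type (F : finFieldType) (n : nat) : finType :=
  {v : 'rV[F]_n.+1 | (rVpoly v \is monic) && irreducibleb (rVpoly v)}.

Definition irr_poly (F : finFieldType) (n : nat) (i : irr_type F n) : {poly F} :=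
  rVpoly (val i).

Definition irr_deg (F : finFieldType) (n : nat) (i : irr_type F n) : nat :=
  (size (irr_poly i)).-1.

Lemma irr_poly_monic (F : finFieldType) (n : nat) (i : irr_type F n) :
  irr_poly i \is monic.
Proof. by have /andP[] := valP i. Qed.

Lemma irr_polyP (F : finFieldType) (n : nat) (i : irr_type F n) :
  irreducible_poly (irr_poly i).
Proof. by have /andP[_ /irreducibleP] := valP i. Qed.

Lemma irr_poly_inj (F : finFieldType) (n : nat) : injective (@irr_poly F n).
Proof. by move=> i j E; apply/val_inj/(can_inj rVpolyK). Qed.

Lemma irr_deg_gt0 (F : finFieldType) (n : nat) (i : irr_type F n) : (0 < irr_deg i)%N.
Proof. by rewrite /irr_deg -ltnS; case: (irr_polyP i); case: (size _). Qed.

Lemma irr_deg_le (F : finFieldType) (n : nat) (i : irr_type F n) : (irr_deg i <= n)%N.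
Proof. by rewrite /irr_deg -ltnS prednK ?size_poly // ltnW //; case: (irr_polyP i). Qed.

Lemma size_prod_irr (F : finFieldType) (n : nat) (m : irr_type F n -> nat) :
  size (\prod_i irr_poly i ^+ m i) = (\sum_i m i * irr_deg i).+1.
Proof.
elim/big_rec2: _ => [|i k f _ IH]; first by rewrite size_poly1.
have mi : irr_poly i ^+ m i \is monic by rewrite monic_exp // irr_poly_monic.
have f0 : f != 0 by rewrite -size_poly_eq0 IH.
rewrite size_monicM // IH addnS /= [(m i * _)%N]mulnC -size_exp.
by rewrite -addSn prednK // lt0n size_poly_eq0 monic_neq0.
Qed.

Lemma prod_irr_monic (F : finFieldType) (n : nat) (m : irr_type F n -> nat) :
  \prod_i irr_poly i ^+ m i \is monic.
Proof. by apply: monic_prod => i _; rewrite monic_exp // irr_poly_monic. Qed.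

Lemma irr_factorization (F : finFieldType) (n : nat) (f : {poly F}) :
  f \is monic -> (size f <= n.+1)%N ->
  exists m : irr_type F n -> nat, f = \prod_i irr_poly i ^+ m i.
Proof.
have [k] := ubnP (size f); elim: k f => // k IH f /ltnSE fk mf fn.
have [irr|] := boolP (irreducibleb f).
  have rf : rVpoly (poly_rV f : 'rV[F]_n.+1) = f by rewrite poly_rV_K.
  have Pf : (rVpoly (poly_rV f : 'rV[F]_n.+1) \is monic) &&
     irreducibleb (rVpoly (poly_rV f : 'rV[F]_n.+1)) by rewrite rf mf irr.
  pose i0 : irr_type F n := exist (fun v : 'rV[F]_n.+1 => (rVpoly v \is monic) && irreducibleb (rVpoly v)) _ Pf.
  exists (fun i => i == i0 : nat).
  rewrite (bigD1 i0) //= big1 => [|i /negbTE->]; last by rewrite expr0.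
  by rewrite eqxx mulr1 expr1 -rf.
rewrite negb_and => /orP[|].
  rewrite -leqNgt => f1; exists (fun _ => 0%N); rewrite big1 => [|i _]; last exact: expr0.
  have /size1_polyC E := f1; move: mf; rewrite E => /monicP.
  by rewrite lead_coefC => ->.
rewrite negb_forall => /existsP[q]; rewrite negb_imply -ltnNge => /andP[].
rewrite -Pdiv.Idomain.dvdpE => qf q1.
pose g : {poly F} := (lead_coef q)^-1 *: (q : {poly F}).
have q0 : (q : {poly F}) != 0 by rewrite -size_poly_gt0 (ltn_trans _ q1).
have lq : lead_coef q != 0 by rewrite lead_coef_eq0.
have mg : g \is monic by rewrite monicE lead_coefZ mulVf.
have sg : size g = size q by rewrite size_scale // invr_eq0.
have gf : g %| f by rewrite dvdpZl ?invr_eq0.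
have mh : f %/ g \is monic by rewrite -(monicMl _ mg) mulrC divpK.
have f0 : (0 < size f)%N by rewrite size_poly_gt0 monic_neq0.
have sq : (size q < size f)%N by rewrite (leq_ltn_trans (size_npoly q)) // ltn_predL.
have sh : (size (f %/ g)%R < size f)%N.
  by rewrite size_divp ?monic_neq0 // sg ltn_subrL f0 andbT -subn1 subn_gt0.
have [m1 E1] : exists m : irr_type F n -> nat, g = \prod_i irr_poly i ^+ m i.
  by apply: IH => //; rewrite sg; [apply: leq_trans sq fk|apply: leq_trans (ltnW sq) fn].
have [m2 E2] : exists m : irr_type F n -> nat, f %/ g = \prod_i irr_poly i ^+ m i.
  by apply: IH => //; [apply: leq_trans sh fk|apply: leq_trans (ltnW sh) fn].
exists (fun i => (m1 i + m2 i)%N); rewrite -{1}(divpK gf) E2 {1}E1 mulrC -big_split.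
by apply: eq_bigr => i _; rewrite exprD.
Qed.

Lemma irr_factorization_uniq (F : finFieldType) (n : nat) (m m' : irr_type F n -> nat) :
  \prod_i irr_poly i ^+ m i = \prod_i irr_poly i ^+ m' i -> m =1 m'.
Proof.
have cop i (l : irr_type F n -> nat) :
    coprimep (irr_poly i) (\prod_(j | j != i) irr_poly j ^+ l j).
  rewrite -big_filter; apply: coprimep_prod_exp => j; rewrite mem_filter => /andP[ji _].
  apply: coprimep_monic_irreducible; rewrite ?irr_poly_monic //; try exact: irr_polyP.
  by rewrite (inj_eq (@irr_poly_inj F n)) eq_sym.
move=> E i; wlog lt : m m' E / (m i < m' i)%N.
  by move=> W; have [/(W _ _ E)|/(W _ _ (esym E))->|] := ltngtP (m i) (m' i).
move: E; rewrite (bigD1 i) // [RHS](bigD1 i) //= -(subnKC lt) addSnnS exprD -mulrA.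
move/(mulfI (expf_neq0 _ (monic_neq0 (irr_poly_monic i)))) => E.
have := cop i m; rewrite E exprS -mulrA coprimepMr coprimepp.
by case: (irr_polyP i) => /gtn_eqF->.
Qed.

(** Unique factorization as a change of variables. Factors have positive degree, so exponents are at
    most k and fit in ['I_n.+1]. *)
Lemma sum_monic_factor (F : finFieldType) (n k : nat) (phi : {poly F} -> rat) :
  (k <= n)%N ->
  \sum_(v : 'rV[F]_k) phi ('X^k + rVpoly v) =
  \sum_(m : {ffun irr_type F n -> 'I_n.+1} | (\sum_i m i * irr_deg i == k)%N)
    phi (\prod_i irr_poly i ^+ m i).
Proof.
move=> kn; pose prodm (m : {ffun irr_type F n -> 'I_n.+1}) := \prod_i irr_poly i ^+ m i.
pose h m : 'rV[F]_k := poly_rV (prodm m - 'X^k).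
pose A := [set m : {ffun irr_type F n -> 'I_n.+1} | (\sum_i m i * irr_deg i == k)%N].
have hK m : m \in A -> 'X^k + rVpoly (h m) = prodm m.
  rewrite inE => /eqP Ek; rewrite poly_rV_K; first by rewrite addrC subrK.
  have sp : size (prodm m) = k.+1 by rewrite size_prod_irr Ek.
  have := prod_irr_monic (fun i => m i : nat); rewrite -/(prodm m) monicE lead_coefE sp /=.
  move=> /eqP lc; apply/leq_sizeP => j kj; rewrite coefB coefXn.
  have [->|nj] := eqVneq j k; first by rewrite lc subrr.
  by rewrite nth_default ?subr0 // sp ltn_neqAle eq_sym nj.
have inj : {in A &, injective h}.
  move=> m m' mA m'A E; apply/ffunP => i; apply: val_inj.
  have : prodm m = prodm m' by rewrite -hK // -[RHS]hK // E.
  by move/irr_factorization_uniq => /(_ i).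
have img : h @: A = [set: 'rV[F]_k].
  apply/setP => v; rewrite inE; apply/imsetP.
  have sX : size ('X^k + rVpoly v) = k.+1.
    by rewrite size_polyDl ?size_polyXn // ltnS size_poly.
  have mX : 'X^k + rVpoly v \is monic.
    rewrite monicE lead_coefDl ?lead_coefXn // size_polyXn ltnS size_poly //.
  have [|m Em] := @irr_factorization F n _ mX; first by rewrite sX.
  have Ek : (\sum_i m i * irr_deg i = k)%N.
    by apply: succn_inj; rewrite -size_prod_irr -Em.
  have mn i : (m i < n.+1)%N.
    rewrite ltnS (leq_trans _ kn) // -Ek (bigD1 i) //= (leq_trans _ (leq_addr _ _)) //.
    by rewrite leq_pmulr // irr_deg_gt0.
  pose m' := [ffun i => Ordinal (mn i)].
  have mE i : m' i = m i :> nat by rewrite ffunE.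
  have m'A : m' \in A.
    by rewrite inE -Ek; apply/eqP/eq_bigr => i _; rewrite mE.
  exists m' => //; apply/(can_inj rVpolyK)/(addrI 'X^k); rewrite hK // Em.
  by apply: eq_bigr => i _; rewrite mE.
rewrite (eq_bigl [in [set: 'rV[F]_k]]) => [|v]; last by rewrite inE.
rewrite -img big_imset //=; apply: eq_big => [m|m mA]; first by rewrite inE.
by rewrite hK.
Qed.

Lemma sum_factor_coef (F : finFieldType) (n k : nat) (u : irr_type F n -> nat -> rat) :
  \sum_(m : {ffun irr_type F n -> 'I_n.+1} | (\sum_i m i * irr_deg i == k)%N)
    \prod_i u i (m i) =
  (\prod_i \sum_(j < n.+1) u i j *: 'X^(j * irr_deg i))`_k.
Proof.
rewrite bigA_distr_bigA /= coef_sum [LHS]big_mkcond /=; apply: eq_bigr => m _.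
have -> : \prod_i (u i (m i) *: 'X^(m i * irr_deg i)) =
    (\prod_i u i (m i)) *: 'X^(\sum_i m i * irr_deg i) :> {poly rat}.
  elim/big_rec3: _ => [|i e a f _ ->]; first by rewrite expr0 scale1r.
  by rewrite -scalerAl -scalerAr scalerA exprD.
by rewrite coefZ coefXn eq_sym; case: eqP; rewrite ?mulr1 ?mulr0.
Qed.

Definition irr_count (F : finFieldType) (n d : nat) : nat :=
  #|[set i : irr_type F n | irr_deg i == d]|.

Definition irr_count_unit (F : finFieldType) (n d : nat) : nat :=
  #|[set i : irr_type F n | (irr_deg i == d) && (irr_poly i != 'X)]|.

Lemma prod_irr_deg (F : finFieldType) (n : nat) (P : pred (irr_type F n))
    (G : nat -> {poly rat}) :
  \prod_(i | P i) G (irr_deg i) =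
  \prod_(d < n.+1) G d ^+ #|[set i : irr_type F n | (irr_deg i == d) && P i]|.
Proof.
rewrite (partition_big (fun i => inord (irr_deg i) : 'I_n.+1) xpredT) //=.
apply: eq_bigr => d _; rewrite -prodr_const; apply: eq_big => [i|i].
  rewrite inE andbC; congr (_ && _); rewrite -val_eqE /= inordK ?ltnS ?irr_deg_le //.
by case/andP=> _ /eqP <-; rewrite inordK ?ltnS ?irr_deg_le.
Qed.

(** The zeta function of the affine line: with all weights 1 the Euler product counts the monic
    polynomials of degree [k]. The truncated geometric series are exact up to degree [n]. *)
Lemma geometric_irr_count (F : finFieldType) (n k : nat) : (k <= n)%N ->
  (\prod_(d < n.+1) (\sum_(j < n.+1) 'X^(j * d)) ^+ irr_count F n d)`_k =
  #|F|%:R ^+ k :> rat.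
Proof.
move=> kn; have := sum_monic_factor (F := F) (fun _ => 1) kn.
rewrite sumr_const card_mx mul1n natrX => ->.
transitivity (\prod_(i : irr_type F n) (\sum_(j < n.+1) 'X^(j * irr_deg i)) : {poly rat})`_k.
  rewrite (prod_irr_deg xpredT (fun d => \sum_(j < n.+1) 'X^(j * d))).
  apply: (congr1 (fun f : {poly rat} => f`_k)); apply: eq_bigr => d _; congr (_ ^+ _).
  by apply: eq_card => i; rewrite !inE andbT.
apply: esym; transitivity (\sum_(m : {ffun irr_type F n -> 'I_n.+1} |
    (\sum_i m i * irr_deg i == k)%N) \prod_(i : irr_type F n) (1 : rat)).
  by apply: eq_bigr => m _; rewrite big1.
rewrite (sum_factor_coef k (fun _ _ => 1)).
apply: (congr1 (fun f : {poly rat} => f`_k)); apply: eq_bigr => i _; apply: eq_bigr => j _; by rewrite scale1r.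
Qed.

Lemma irr_poly_root0 (F : finFieldType) (n : nat) (i : irr_type F n) :
  ((irr_poly i).[0] == 0) = (irr_poly i == 'X).
Proof.
apply/eqP/eqP => [r0|->]; last by rewrite hornerX.
have Xi : 'X %| irr_poly i by rewrite -['X]subr0 -[0]/(0%:P) dvdp_XsubCl; apply/eqP.
have [_ irr] := irr_polyP i; apply/esym/eqP; rewrite -eqp_monic ?monicX ?irr_poly_monic //.
by apply: irr => //; rewrite size_polyX.
Qed.

Lemma sum_moebius_cube (F : finFieldType) (n : nat) :
  (\sum_(g : 'M[F]_n | g \in unitmx) moebius g 1%:M ^+ 3) / (card_unitmx F n)%:R =
  (\prod_(d < n.+1) (\sum_(j < n.+1) local_weight (#|F| ^ d)%:R j *: 'X^(j * d))
     ^+ irr_count_unit F n d)`_n.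
Proof.
pose phi (f : {poly F}) := if f.[0] == 0 then 0 else char_sum n f.
transitivity (\sum_(v : 'rV[F]_n) phi ('X^n + rVpoly v)).
  rewrite mulr_suml (partition_big (fun g => poly_rV (char_poly g - 'X^n) : 'rV[F]_n) xpredT) //=.
  apply: eq_bigr => v _; rewrite /phi /char_sum.
  have Ec (g : 'M[F]_n) : (poly_rV (char_poly g - 'X^n) == v) = (char_poly g == 'X^n + rVpoly v).
    have sz : (size (char_poly g - 'X^n)%R <= n)%N.
      apply/leq_sizeP => j nj; rewrite coefB coefXn.
      have [->|nj'] := eqVneq j n.
        by have := char_poly_monic g; rewrite monicE lead_coefE size_char_poly => /eqP->; rewrite subrr.
      by rewrite nth_default ?subr0 // size_char_poly ltn_neqAle eq_sym nj'.
    by rewrite -(can_eq rVpolyK) poly_rV_K // subr_eq addrC.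
  have Eu (g : 'M[F]_n) : (g \in unitmx) = ((char_poly g).[0] != 0).
    by rewrite horner_coef0 char_poly_det mulf_eq0 signr_eq0 unitmxE unitfE.
  rewrite (eq_bigl (fun g => (char_poly g == 'X^n + rVpoly v) && (('X^n + rVpoly v).[0] != 0))); last first.
    by move=> g; rewrite Ec Eu andbC; case: eqP => // ->.
  case: eqP => _ /=; first by rewrite big_pred0 // => g; rewrite andbF.
  by rewrite mulr_suml; apply: eq_bigl => g; rewrite andbT.
rewrite (sum_monic_factor phi (leqnn n)).
(* Invertibility of a matrix means that X does not divide its characteristic polynomial; the weight
   of X is therefore the indicator of exponent 0, and its Euler factor is 1. *)
pose u (i : irr_type F n) j : rat :=
  if irr_poly i == 'X then (j == 0%N)%:R else local_weight (#|F| ^ irr_deg i)%:R j.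
transitivity (\sum_(m : {ffun irr_type F n -> 'I_n.+1} | (\sum_i m i * irr_deg i == n)%N)
    \prod_i u i (m i)).
  apply: eq_bigr => m /eqP Em; rewrite /phi.
  have cs : char_sum n (\prod_i irr_poly i ^+ m i) =
      \prod_i local_weight (#|F| ^ irr_deg i)%:R (m i).
    have := char_sum_prod (fun i => m i : nat) (index_enum_uniq _) (@irr_poly_inj F n)
      (@irr_poly_monic F n) (@irr_polyP F n).
    by rewrite Em.
  rewrite horner_prod; case: eqP => [/eqP|] E.
    have /prodf_eq0 [i _] := E; rewrite horner_exp expf_eq0 irr_poly_root0 => /andP[mi iX].
    by apply/esym/eqP/prodf_eq0; exists i => //; rewrite /u iX eqn0Ngt mi.
  rewrite cs; apply: eq_bigr => i _; rewrite /u; case: eqP => // iX.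
  have mi : m i = 0%N :> nat.
    apply/eqP; rewrite -leqn0 leqNgt; apply/negP => mi; case: E; apply/eqP/prodf_eq0.
    by exists i => //; rewrite horner_exp expf_eq0 irr_poly_root0 iX eqxx mi.
  by rewrite mi /local_weight big_ord0.
rewrite sum_factor_coef (bigID (fun i => irr_poly i != 'X)) /= mulrC big1 ?mul1r => [|i]; last first.
  rewrite negbK => iX; rewrite big_ord_recl /= /u iX eqxx scale1r mul0n expr0 big1 ?addr0 // => j _.
  by rewrite scale0r.
rewrite -(prod_irr_deg (fun i => irr_poly i != 'X)
   (fun d => \sum_(j < n.+1) local_weight (#|F| ^ d)%:R j *: 'X^(j * d))).
apply: (congr1 (fun f : {poly rat} => f`_n)); apply: eq_bigr => i iX; apply: eq_bigr => j _.
by rewrite /u (negbTE iX).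
Qed.

(** * Rational functions of the cardinality of the field *)

(* phi is a rational function of q = #|F| equivalent to c q^k at infinity
   (of order less than q^k when c = 0). *)
Definition asym (phi : finFieldType -> rat) (k : nat) (c : rat) : Prop :=
  exists A B : {poly rat}, [/\ forall F : finFieldType, B.[#|F|%:R] != 0,
    forall F : finFieldType, phi F = A.[#|F|%:R] / B.[#|F|%:R] &
    (size (A - c *: ('X^k * B))%R < size B + k)%N].

Lemma asym_ext (phi psi : finFieldType -> rat) (k : nat) (c : rat) :
  (forall F, phi F = psi F) -> asym psi k c -> asym phi k c.
Proof. by move=> E [A [B [B0 H s]]]; exists A, B; split=> // F; rewrite E. Qed.

Lemma asym_den_neq0 (B : {poly rat}) :
  (forall F : finFieldType, B.[#|F|%:R] != 0) -> B != 0.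
Proof. by move=> /(_ 'F_2); apply: contraNneq => ->; rewrite horner0. Qed.

Lemma asym_zero (k : nat) : asym (fun _ => 0) k 0.
Proof.
exists 0, 1; split=> [F|F|]; rewrite ?hornerC ?oner_eq0 ?mul0r //.
by rewrite scale0r subrr size_poly0 size_poly1.
Qed.

Lemma asym_const (c : rat) : asym (fun _ => c) 0 c.
Proof.
exists c%:P, 1; split=> [F|F|]; rewrite ?hornerC ?oner_eq0 ?divr1 //.
by rewrite expr0 mulr1 alg_polyC subrr size_poly0 size_poly1.
Qed.

Lemma size_expXM (R : idomainType) (k : nat) (B : {poly R}) :
  B != 0 -> size ('X^k * B) = (size B + k)%N.
Proof.
move=> B0; rewrite size_mul ?expf_neq0 ?polyX_eq0 // size_polyXn /=.
by rewrite addnC.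
Qed.

Lemma size_bound (a a' b b' k l : nat) :
  (a < b + k -> a' <= b' + l -> 0 < b -> 0 < b' ->
   (a + a').-1 < (b + b').-1 + (k + l))%N.
Proof. lia. Qed.

Lemma asym_add (phi psi : finFieldType -> rat) (k : nat) (c d : rat) :
  asym phi k c -> asym psi k d -> asym (fun F => phi F + psi F) k (c + d).
Proof.
move=> [A [B [B0 HA sA]]] [A' [B' [B0' HA' sA']]].
exists (A * B' + A' * B), (B * B'); split=> [F|F|].
- by rewrite hornerM mulf_neq0.
- by rewrite hornerD !hornerM HA HA' addf_div.
have nB := asym_den_neq0 B0; have nB' := asym_den_neq0 B0'.
have -> : A * B' + A' * B - (c + d) *: ('X^k * (B * B')) =
  (A - c *: ('X^k * B)) * B' + (A' - d *: ('X^k * B')) * B.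
  by rewrite -!mul_polyC polyCD; ring.
have sB : (0 < size B)%N by rewrite size_poly_gt0.
have sB' : (0 < size B')%N by rewrite size_poly_gt0.
rewrite (leq_ltn_trans (size_polyD _ _)) // gtn_max (size_mul nB nB').
have s1 := size_polyMleq (A - c *: ('X^k * B)) B'.
have s2 := size_polyMleq (A' - d *: ('X^k * B')) B.
apply/andP; split; [apply: leq_ltn_trans s1 _|apply: leq_ltn_trans s2 _].
  by have := size_bound sA (leq_addr 0 _) sB sB'; rewrite addn0.
by have := size_bound sA' (leq_addr 0 _) sB' sB; rewrite addn0 [(size B' + size B)%N]addnC.
Qed.

Lemma asym_mul (phi psi : finFieldType -> rat) (k l : nat) (c d : rat) :
  asym phi k c -> asym psi l d -> asym (fun F => phi F * psi F) (k + l) (c * d).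
Proof.
move=> [A [B [B0 HA sA]]] [A' [B' [B0' HA' sA']]].
exists (A * A'), (B * B'); split=> [F|F|].
- by rewrite hornerM mulf_neq0.
- by rewrite !hornerM HA HA' mulf_div.
have nB := asym_den_neq0 B0; have nB' := asym_den_neq0 B0'.
have -> : A * A' - (c * d) *: ('X^(k + l) * (B * B')) =
  (A - c *: ('X^k * B)) * A' + (A' - d *: ('X^l * B')) * (c *: ('X^k * B)).
  by rewrite -!mul_polyC polyCM exprD; ring.
have sB : (0 < size B)%N by rewrite size_poly_gt0.
have sB' : (0 < size B')%N by rewrite size_poly_gt0.
have sA'' : (size A' <= size B' + l)%N.
  rewrite -[A'](subrK (d *: ('X^l * B'))) (leq_trans (size_polyD _ _)) // geq_max.
  by rewrite (ltnW sA') (leq_trans (size_scale_leq _ _)) // size_expXM.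
have sX : (size (c *: ('X^k * B))%R <= size B + k)%N.
  by rewrite (leq_trans (size_scale_leq _ _)) // size_expXM.
rewrite (leq_ltn_trans (size_polyD _ _)) // gtn_max (size_mul nB nB').
have s1 := size_polyMleq (A - c *: ('X^k * B)) A'.
have s2 := size_polyMleq (A' - d *: ('X^l * B')) (c *: ('X^k * B)).
apply/andP; split; [apply: leq_ltn_trans s1 _|apply: leq_ltn_trans s2 _].
  exact: size_bound sA sA'' sB sB'.
rewrite [(k + l)%N]addnC [(size B + _)%N]addnC.
exact: size_bound sA' sX sB' sB.
Qed.

Lemma asym_lift (phi : finFieldType -> rat) (k l : nat) (c : rat) :
  asym phi k c -> (k < l)%N -> asym phi l 0.
Proof.
move=> [A [B [B0 HA sA]]] kl; exists A, B; split=> //; rewrite scale0r subr0.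
have nB := asym_den_neq0 B0.
rewrite -[A](subrK (c *: ('X^k * B))) (leq_ltn_trans (size_polyD _ _)) // gtn_max.
apply/andP; split; first by apply: leq_trans sA _; rewrite leq_add2l ltnW.
by apply: leq_ltn_trans (size_scale_leq _ _) _; rewrite size_expXM // ltn_add2l.
Qed.

Lemma asym_liftW (phi : finFieldType -> rat) (k l : nat) (c : rat) :
  asym phi k c -> (k <= l)%N -> asym phi l (if k == l then c else 0).
Proof.
move=> H; rewrite leq_eqVlt => /orP[/eqP<-|kl]; first by rewrite eqxx.
by rewrite ltn_eqF //; apply: asym_lift H kl.
Qed.

Lemma asym_scale (phi : finFieldType -> rat) (k : nat) (a c : rat) :
  asym phi k c -> asym (fun F => a * phi F) k (a * c).
Proof. exact: asym_mul (asym_const a). Qed.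

Lemma asym_sum (I : Type) (r : seq I) (phi : I -> finFieldType -> rat) (k : nat)
    (c : I -> rat) :
  (forall i, asym (phi i) k (c i)) ->
  asym (fun F => \sum_(i <- r) phi i F) k (\sum_(i <- r) c i).
Proof.
move=> H; elim: r => [|i r IH].
  by rewrite big_nil; apply: (asym_ext _ (asym_zero k)) => F; rewrite big_nil.
rewrite big_cons; apply: (asym_ext _ (asym_add (H i) IH)) => F.
by rewrite big_cons.
Qed.

Lemma asym_card_exp (k : nat) : asym (fun F => #|F|%:R ^+ k) k 1.
Proof.
exists 'X^k, 1; split=> [F|F|]; rewrite ?hornerC ?oner_eq0 ?hornerXn ?divr1 //.
by rewrite mulr1 scale1r subrr size_poly0 size_poly1.
Qed.

Lemma asym_div_card (phi : finFieldType -> rat) (k : nat) (c : rat) :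
  asym phi k c -> asym (fun F => phi F / #|F|%:R ^+ k) 0 c.
Proof.
have q0 (F : finFieldType) : #|F|%:R ^+ k != 0 :> rat.
  by rewrite expf_neq0 // pnatr_eq0 -lt0n (ltnW (finRing_gt1 F)).
move=> [A [B [B0 HA sA]]]; exists A, ('X^k * B); split=> [F|F|].
- by rewrite hornerM hornerXn mulf_neq0.
- by rewrite hornerM hornerXn HA invfM mulrA mulrAC.
by rewrite expr0 mul1r addn0 size_expXM // asym_den_neq0.
Qed.

Lemma asym_frac (k : nat) (A B : {poly rat}) :
  (forall F : finFieldType, B.[#|F|%:R] != 0) -> A \is monic -> B \is monic ->
  size A = (size B + k)%N -> asym (fun F => A.[#|F|%:R] / B.[#|F|%:R]) k 1.
Proof.
move=> B0 mA mB sz; exists A, B; split=> //; rewrite scale1r.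
have B1 : (0 < size B)%N by rewrite size_poly_gt0 monic_neq0.
have E : (size B + k)%N = (size B + k).-1.+1 by rewrite prednK // addn_gt0 B1.
rewrite E ltnS; apply/leq_sizeP => j kj; rewrite coefB.
have [ej|nj] := eqVneq j (size B + k).-1.
  rewrite ej -{1}sz -size_expXM ?monic_neq0 // -!lead_coefE (monicP mA).
  have mXB : 'X^k * B \is monic by rewrite monicMr // monicXn.
  by rewrite (monicP mXB) subrr.
have jj : (size B + k <= j)%N by rewrite E ltn_neqAle eq_sym nj.
by rewrite !nth_default ?subr0 // ?sz // size_expXM ?monic_neq0.
Qed.

(** * Binomial coefficients and power series with prescribed orders *)

Lemma natr_ffact (R : numDomainType) (N k : nat) :
  (N ^_ k)%:R = \prod_(i < k) (N%:R - i%:R) :> R.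
Proof.
elim: k => [|k IH]; first by rewrite big_ord0.
rewrite big_ord_recr /= -IH ffactnSr natrM.
have [kN|Nk] := leqP k N; first by rewrite natrB.
by rewrite ffact_small // !mul0r.
Qed.

(** The falling factorial is a product of factors N - l, and since [d > 0] the constant l is
    negligible in each. *)
Lemma asym_binomial (N : finFieldType -> nat) (d k : nat) (c : rat) : (0 < d)%N ->
  asym (fun F => (N F)%:R) d c ->
  asym (fun F => 'C(N F, k)%:R) (k * d) (c ^+ k / k`!%:R).
Proof.
move=> d0 HN.
have k0 : k`!%:R != 0 :> rat by rewrite pnatr_eq0 -lt0n fact_gt0.
have ff l : asym (fun F => (N F ^_ l)%:R) (l * d) (c ^+ l).
  elim: l => [|l IH]; first exact: asym_const 1.
  have Hl : asym (fun F => (N F)%:R - l%:R) d c.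
    rewrite -[c]addr0; apply: asym_add => //.
    by apply: asym_lift d0; apply: asym_const.
  rewrite mulSnr exprSr; apply: asym_ext (asym_mul IH Hl) => F.
  by rewrite !natr_ffact big_ord_recr.
rewrite mulrC; apply: asym_ext (asym_scale _ (ff k)) => F.
by apply: (mulfI k0); rewrite mulrA mulfV // mul1r -natrM mulnC bin_ffact.
Qed.

(** Coefficientwise asymptotics up to degree [n]: [f] bounds the orders, and [C] holds the leading
    coefficients at those orders, possibly zero. *)
Definition ser (n : nat) (f : nat -> nat) (Phi : finFieldType -> {poly rat})
    (C : nat -> rat) : Prop :=
  forall i, (i <= n)%N -> asym (fun F => (Phi F)`_i) (f i) (C i).

(** The leading coefficients of a product: for superadditive [f], a term of the Cauchy product
    reaches order [f k] only where superadditivity is an equality. *)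
Definition conv (f : nat -> nat) (C D : nat -> rat) (k : nat) : rat :=
  \sum_(i < k.+1) if (f i + f (k - i) == f k)%N then C i * D (k - i)%N else 0.

Lemma ser_ext (n : nat) (f : nat -> nat) (Phi Psi : finFieldType -> {poly rat})
    (C D : nat -> rat) :
  (forall F i, (i <= n)%N -> (Phi F)`_i = (Psi F)`_i) ->
  (forall i, (i <= n)%N -> C i = D i) -> ser n f Psi D -> ser n f Phi C.
Proof.
move=> E1 E2 H i ik; rewrite E2 //; apply: asym_ext (H i ik) => F; exact: E1.
Qed.

Lemma ser_mul (n : nat) (f : nat -> nat) (Phi Psi : finFieldType -> {poly rat})
    (C D : nat -> rat) :
  (forall i j, (f i + f j <= f (i + j))%N) ->
  ser n f Phi C -> ser n f Psi D -> ser n f (fun F => Phi F * Psi F) (conv f C D).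
Proof.
move=> fD HC HD k kn.
apply: (asym_ext (psi := fun F => \sum_(i < k.+1) (Phi F)`_i * (Psi F)`_(k - i))).
  by move=> F; rewrite coefM.
apply: (asym_sum _ (phi := fun (i : 'I_k.+1) F => (Phi F)`_i * (Psi F)`_(k - i))) => i.
have ik : (i <= k)%N by rewrite -ltnS.
apply: asym_liftW; last by have := fD i (k - i)%N; rewrite subnKC.
apply: asym_mul; [apply: HC|apply: HD]; first exact: leq_trans ik kn.
by apply: leq_trans kn; apply: leq_subr.
Qed.

Lemma ser_one (n : nat) (f : nat -> nat) : f 0%N = 0%N ->
  ser n f (fun _ => 1) (fun i => (i == 0%N)%:R).
Proof.
move=> f0 [|i] _; rewrite ?f0.
  by apply: asym_ext (asym_const 1) => F; rewrite coef1.
by apply: asym_ext (asym_zero _) => F; rewrite coef1.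
Qed.

Lemma ser_exp (n k : nat) (f : nat -> nat) (Phi : finFieldType -> {poly rat})
    (C : nat -> rat) :
  f 0%N = 0%N -> (forall i j, (f i + f j <= f (i + j))%N) -> ser n f Phi C ->
  ser n f (fun F => Phi F ^+ k) (iter k (conv f C) (fun i => (i == 0%N)%:R)).
Proof.
move=> f0 fD H; elim: k => [|k IH]; first exact: ser_one.
by apply: (ser_ext _ _ (ser_mul fD H IH)) => // F i _; rewrite exprS.
Qed.

Lemma sum_ord_trunc (R : nmodType) (a b : nat) (G : nat -> R) :
  (a <= b)%N -> (forall k, (a <= k)%N -> G k = 0) ->
  \sum_(k < b) G k = \sum_(k < a) G k.
Proof.
move=> ab G0; rewrite -!(big_mkord xpredT) (big_cat_nat _ ab) //=.
by rewrite [X in _ + X]big_nat_cond [X in _ + X]big1 ?addr0 // => k /andP[/andP[/G0]].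
Qed.

Lemma coef_exp_low (R : nzRingType) (U : {poly R}) (i k : nat) :
  U`_0 = 0 -> (i < k)%N -> (U ^+ k)`_i = 0.
Proof.
move=> U0; elim: k i => // k IH i; rewrite ltnS => ik.
rewrite exprS coefM big1 // => -[[|j] /= ji] _; first by rewrite U0 mul0r.
rewrite IH ?mulr0 //; apply: leq_trans ik.
by rewrite ltn_subrL (leq_ltn_trans (leq0n j) ji).
Qed.

(** U^k starts in degree k, and binomial coefficients vanish beyond [N]. The range is thus
    independent of [N], which will vary with the field. *)
Lemma coef_binomial (R : comNzRingType) (n N i : nat) (U : {poly R}) :
  U`_0 = 0 -> (i <= n)%N ->
  ((1 + U) ^+ N)`_i = \sum_(k < n.+1) 'C(N, k)%:R * (U ^+ k)`_i.
Proof.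
move=> U0 ik; rewrite addrC exprD1n coef_sum.
rewrite (eq_bigr (fun k : 'I_N.+1 => 'C(N, k)%:R * (U ^+ k)`_i)); last first.
  by move=> k _; rewrite coefMn mulr_natl.
rewrite -(sum_ord_trunc (G := fun k => 'C(N, k)%:R * (U ^+ k)`_i) (leq_addr n.+1 N.+1)).
  rewrite (sum_ord_trunc (G := fun k => 'C(N, k)%:R * (U ^+ k)`_i) (leq_addl N.+1 n.+1)) //.
  by move=> k nk; rewrite coef_exp_low ?mulr0 // (leq_ltn_trans ik).
by move=> k Nk; rewrite bin_small // mul0r.
Qed.

(* The binomial coefficient has order q^(dk): it is balanced against the k-th power of
   q^d U, whose coefficients are assumed to have nonnegative order. *)
Lemma ser_binomial (n d : nat) (f : nat -> nat) (N : finFieldType -> nat)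
    (U : finFieldType -> {poly rat}) (c : rat) (C : nat -> rat) :
  f 0%N = 0%N -> (forall i j, (f i + f j <= f (i + j))%N) -> (0 < d)%N ->
  (forall F, (U F)`_0 = 0) -> asym (fun F => (N F)%:R) d c ->
  ser n f (fun F => #|F|%:R ^+ d *: U F) C ->
  ser n f (fun F => (1 + U F) ^+ N F)
    (fun i => \sum_(k < n.+1) c ^+ k / k`!%:R *
       iter k (conv f C) (fun i => (i == 0%N)%:R) i).
Proof.
move=> f0 fD d0 U0 HN HU i ik.
have q0 (F : finFieldType) : #|F|%:R != 0 :> rat.
  by rewrite pnatr_eq0 -lt0n (ltnW (finRing_gt1 F)).
apply: (asym_ext (psi := fun F => \sum_(k < n.+1)
   ('C(N F, k)%:R / #|F|%:R ^+ (k * d)) * ((#|F|%:R ^+ d *: U F) ^+ k)`_i)).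
  move=> F; rewrite (coef_binomial (n := n)) //; apply: eq_bigr => k _.
  rewrite exprZn coefZ -exprM [(d * k)%N]mulnC mulrA divfK //.
  by rewrite expf_neq0.
apply: (asym_sum _ (phi := fun (k : 'I_n.+1) F =>
  ('C(N F, k)%:R / #|F|%:R ^+ (k * d)) * ((#|F|%:R ^+ d *: U F) ^+ k)`_i)) => k.
rewrite -[f i]add0n; apply: asym_mul; first exact/asym_div_card/asym_binomial.
exact: (ser_exp k f0 fD HU).
Qed.

(** Congruence to 1 modulo X^d. *)
Definition low (R : nzRingType) (d : nat) (G : {poly R}) : Prop :=
  forall i, (i < d)%N -> G`_i = (i == 0%N)%:R.

Lemma low_leq (R : nzRingType) (d e : nat) (G : {poly R}) :
  (d <= e)%N -> low e G -> low d G.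
Proof. by move=> de H i id; apply: H; apply: leq_trans id de. Qed.

Lemma low_mul (R : nzRingType) (d : nat) (G K : {poly R}) :
  low d G -> low d K -> low d (G * K).
Proof.
move=> HG HK i id; rewrite coefM big_ord_recl /= subn0 HG ?(leq_ltn_trans _ id) //.
rewrite HK // mul1r big1 ?addr0 // => j _.
by rewrite HG ?mul0r // (leq_trans _ id) // ltnS; apply: ltn_ord j.
Qed.

Lemma low_exp (R : nzRingType) (d k : nat) (G : {poly R}) : low d G -> low d (G ^+ k).
Proof.
move=> H; elim: k => [|k IH]; first by move=> i _; rewrite expr0 coef1.
by rewrite exprS; apply: low_mul.
Qed.

Lemma coef_low_mul (R : nzRingType) (d : nat) (G K : {poly R}) : (0 < d)%N ->
  low d G -> (G * K)`_d = K`_d + G`_d * K`_0.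
Proof.
case: d => // d _ H; rewrite coefM big_ord_recl big_ord_recr /= subn0 H //= mul1r.
rewrite subnn big1 ?add0r // => j _.
by rewrite H ?mul0r //= /bump leq0n add1n ltnS.
Qed.

Lemma coef_low_exp (R : nzRingType) (d k : nat) (G : {poly R}) : (0 < d)%N ->
  low d G -> (G ^+ k)`_d = G`_d *+ k.
Proof.
move=> d0 H; elim: k => [|k IH]; first by rewrite expr0 coef1 gtn_eqF.
have L := @low_exp R d k G H 0%N d0.
by rewrite exprS coef_low_mul // IH L mulr1 mulrSr.
Qed.

(** * Leading terms *)

Definition geom (n e : nat) : {poly rat} := \sum_(j < n.+1) 'X^(j * e).

Lemma coef_geom (n e i : nat) : (0 < e)%N -> (i <= n)%N ->
  (geom n e)`_i = (e %| i)%:R.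
Proof.
move=> e0 ik; rewrite coef_sum; have [ei|ei] := boolP (e %| i)%N; last first.
  rewrite big1 // => j _; rewrite coefXn; case: eqP => // E.
  by rewrite E dvdn_mull in ei.
have lti : (i %/ e < n.+1)%N by rewrite ltnS (leq_trans (leq_div _ _)).
rewrite (bigD1 (Ordinal lti)) //= coefXn divnK // eqxx big1 ?addr0 // => j nj.
rewrite coefXn; case: eqP => // E; case/eqP: nj; apply: val_inj => /=.
by rewrite E mulnK.
Qed.

Lemma geom_low (n e : nat) : (0 < e <= n)%N -> low e (geom n e).
Proof.
case/andP=> e0 en i ie; rewrite coef_geom // ?(leq_trans (ltnW ie)) //.
by case: i ie => [|i] ie; rewrite ?dvdn0 // gtnNdvd.
Qed.

Lemma irr_count0 (F : finFieldType) (n : nat) : irr_count F n 0 = 0%N.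
Proof.
by apply: eq_card0 => i; rewrite !inE eqn0Ngt irr_deg_gt0.
Qed.

(* Comparing the coefficients of degree d in the Euler product isolates irr_count d. *)
Lemma irr_count_rec (F : finFieldType) (n d : nat) : (0 < d <= n)%N ->
  (irr_count F n d)%:R = #|F|%:R ^+ d -
    (\prod_(e < d) geom n e ^+ irr_count F n e)`_d :> rat.
Proof.
move=> /andP[d0 dn]; pose K e := geom n e ^+ irr_count F n e.
have <- : (\prod_(e < n.+1) K e)`_d = #|F|%:R ^+ d by exact: geometric_irr_count.
rewrite -(big_mkord xpredT K) (big_cat_nat (leq0n d)) /=; last by rewrite ltnW.
rewrite (big_ltn (m := d)) ?ltnS // mulrCA big_mkord.
have Ld : low d (geom n d) by apply: geom_low; rewrite d0 dn.
have Kd : low d (K d) := @low_exp _ _ _ _ Ld.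
have high : low d.+1 (\prod_(d.+1 <= e < n.+1) K e).
  rewrite big_nat; elim/big_rec: _ => [i _|e P /andP[de en] IH]; first by rewrite coef1.
  have Le : low e (geom n e) by apply: geom_low; rewrite (leq_trans (ltn0Sn d) de) -ltnS.
  exact: (low_mul (low_leq de (@low_exp _ _ _ _ Le)) IH).
have P0 : (\prod_(e < d) K e)`_0 = 1.
  have : low 1 (\prod_(e < d) K e).
    elim/big_rec: _ => [i _|e P _ IH]; first by rewrite coef1.
    have K0 : low 1 (K e).
      rewrite /K; have [->|e0] := posnP e.
        by rewrite irr_count0 expr0 => i _; rewrite coef1.
      have Le : low e (geom n e).
        by apply: geom_low; rewrite e0 (leq_trans (ltnW (ltn_ord e))).
      exact: (low_leq e0 (@low_exp _ _ _ _ Le)).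
    exact: (low_mul K0 IH).
  by move/(_ 0%N isT).
have PH : forall i, (i <= d)%N -> ((\prod_(e < d) K e) * \prod_(d.+1 <= e < n.+1) K e)`_i = (\prod_(e < d) K e)`_i.
  move=> i id; rewrite mulrC coefM big_ord_recl /= subn0 high // mul1r.
  rewrite [X in _ + X]big1 ?addr0 // => j _; rewrite high ?mul0r //= /bump add1n ltnS.
  by rewrite (leq_trans (ltn_ord j)).
rewrite coef_low_mul // !PH // P0 mulr1 coef_low_exp //.
by rewrite coef_geom // dvdnn addrC addKr.
Qed.

(** Strong induction through [irr_count_rec], with orders bounded by the degree itself. The constant
    stays unspecified: its value will matter for d = 1 and d = 2 alone, where exact counts are
    available. *)
Lemma asym_irr_count (n d : nat) : (0 < d <= n)%N ->
  exists c, asym (fun F => (irr_count F n d)%:R) d c.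
Proof.
have [m] := ubnP d; elim: m d => // m IH d dm /andP[d0 dn].
have fD i j : (id i + id j <= id (i + j))%N by [].
have H (l : nat) : (l <= d)%N ->
    exists C, ser n id (fun F => \prod_(e < l) geom n e ^+ irr_count F n e) C.
  elim: l => [|l IHl] ld.
    exists (fun i => (i == 0%N)%:R).
    have S1 := @ser_one n id (erefl 0%N).
    by apply: ser_ext S1 => // F i _; rewrite big_ord0.
  have [C HC] := IHl (ltnW ld).
  have [l0|l0] := posnP l.
    exists C; apply: ser_ext HC => // F i _.
    by rewrite big_ord_recr /= l0 irr_count0 expr0 mulr1.
  have ln : (l <= n)%N by rewrite (leq_trans (ltnW ld)).
  have [||c Hc] := IH l; first exact: leq_trans ld _.
    by rewrite l0.
  have HU : ser n id (fun F => #|F|%:R ^+ l *: (geom n l - 1))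
      (fun i => if (i == l)%N then 1 else 0).
    move=> i ik.
    have E (F : finFieldType) : (#|F|%:R ^+ l *: (geom n l - 1))`_i =
        if (0 < i)%N && (l %| i)%N then #|F|%:R ^+ l else 0 :> rat.
      rewrite coefZ coefB coef1 coef_geom //.
      by case: i {ik} => [|i]; rewrite ?dvdn0 /= ?subrr ?mulr0 // subr0; case: dvdn; rewrite ?mulr1 ?mulr0.
    apply: asym_ext E _; case: (boolP ((0 < i)%N && (l %| i)%N)) => [/andP[i0 li]|nli].
      by rewrite eq_sym; apply: asym_liftW (asym_card_exp l) (dvdn_leq i0 li).
    case: eqP => [e|_]; last exact: asym_zero.
    by rewrite e l0 dvdnn in nli.
  have U0 (F : finFieldType) : (geom n l - 1)`_0 = 0.
    by rewrite coefB coef1 coef_geom // dvdn0 subrr.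
  have := @ser_binomial n l id _ _ _ _ (erefl 0%N) fD l0 U0 Hc HU.
  move/(ser_mul fD HC); set D := conv _ _ _ => HD; exists D.
  by apply: ser_ext HD => // F i _; rewrite big_ord_recr /= addrC subrK.
have [C HC] := H d (leqnn d).
exists (1 + (-1) * C d).
apply: (asym_ext (psi := fun F => #|F|%:R ^+ d +
    (-1) * (\prod_(e < d) geom n e ^+ irr_count F n e)`_d)).
  by move=> F; rewrite irr_count_rec ?d0 // mulN1r.
by apply: asym_add (asym_card_exp d) _; apply: asym_scale; apply: HC.
Qed.

Lemma irr_count1 (F : finFieldType) (n : nat) : (0 < n)%N ->
  (irr_count F n 1)%:R = #|F|%:R :> rat.
Proof.
move=> n0; rewrite irr_count_rec // big_ord_recl big_ord0 irr_count0 expr0 mulr1.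
by rewrite coef1 subr0.
Qed.

Lemma coefM2 (R : nzRingType) (G K : {poly R}) :
  (G * K)`_2 = G`_0 * K`_2 + G`_1 * K`_1 + G`_2 * K`_0.
Proof. by rewrite coefM !big_ord_recr big_ord0 /= add0r. Qed.

(** The leading coefficient 1/2 takes part in the cancellation in degree 2. *)
Lemma irr_count2 (F : finFieldType) (n : nat) : (1 < n)%N ->
  (irr_count F n 2)%:R = 2^-1 * (#|F|%:R ^+ 2 - #|F|%:R) :> rat.
Proof.
move=> n1; rewrite irr_count_rec // !big_ord_recl big_ord0 irr_count0 expr0 mulr1 mul1r.
have -> : geom n (lift ord0 (ord0 : 'I_1)) = geom n 1 by [].
have -> : irr_count F n (lift ord0 (ord0 : 'I_1)) = #|F|.
  by apply/eqP; rewrite -(eqr_nat rat) irr_count1 // ltnW.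
have E N : (geom n 1 ^+ N)`_1 = N%:R /\ (geom n 1 ^+ N)`_2 = 2^-1 * (N%:R ^+ 2 + N%:R).
  elim: N => [|N [IH1 IH2]]; first by rewrite expr0 !coef1 /=; split; ring.
  have g i : (i <= n)%N -> (geom n 1)`_i = 1 by move=> ik; rewrite coef_geom // dvd1n.
  have N0 : (geom n 1 ^+ N)`_0 = 1.
    have L : low 1 (geom n 1) by apply: geom_low; apply: ltnW n1.
    exact: (@low_exp _ 1 N _ L 0%N isT).
  have L : low 1 (geom n 1) by apply: geom_low; apply: ltnW n1.
  rewrite exprS (coef_low_mul _ _ L) // coefM2 (g 0%N) // (g 1%N) ?(ltnW n1) // (g 2%N) //.
  by rewrite IH1 IH2 N0 -natr1; split; field.
by have [_ ->] := E #|F|; field.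
Qed.

(** This is (i-1)(i-2)/2 for i > 0. The truncated predecessor gives 0 at i = 0, where the formula
    would give 1 and break superadditivity. *)
Definition tri (i : nat) : nat := 'C(i.-1, 2).

Lemma tri_add (i j : nat) : tri (i.+1 + j.+1) = (tri i.+1 + tri j.+1 + i * j + i + j)%N.
Proof.
rewrite /tri addSn /=; elim: i => [|i IH]; first by rewrite add0n binS bin1 bin0n mul0n; lia.
by rewrite addSn binS bin1 IH binS bin1 mulSn; lia.
Qed.

Lemma tri_superadd (i j : nat) : (tri i + tri j <= tri (i + j))%N.
Proof.
have t0 : tri 0 = 0%N by [].
case: i j => [|i] [|j]; rewrite ?t0 ?addn0 ?add0n //.
by rewrite tri_add -!addnA addnA leq_addr.
Qed.

(** The defect in [tri_add] vanishes only for 1 + 1: this is why degree 2 is exceptional. *)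
Lemma tri_add_eq (i j : nat) : (0 < i)%N -> (0 < j)%N ->
  (tri i + tri j == tri (i + j))%N = (i == 1%N) && (j == 1%N).
Proof.
case: i j => [|i] [|j] // _ _; rewrite tri_add.
by apply/eqP/andP => [|[/eqP[->] /eqP[->]]]; lia.
Qed.

Lemma tri_mul (d j : nat) : (d * tri j <= tri (d * j))%N.
Proof.
elim: d => // d IH; rewrite !mulSn; apply: leq_trans (tri_superadd _ _).
by rewrite leq_add2l.
Qed.

(** Among the powers p^j of nonlinear irreducible polynomials, only quadratic p with j = 1 reach the
    top order. *)
Lemma tri_mul_eq (d j : nat) : (1 < d)%N -> (0 < j)%N ->
  (d * tri j == tri (d * j))%N = (d == 2) && (j == 1%N).
Proof.
case: d => [|[|d]] // _ j0; apply/eqP/andP => [E|[/eqP-> /eqP->]]; last by [].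
have := tri_mul d.+1 j; have := tri_superadd j (d.+1 * j).
rewrite -mulSn -E mulSn => h1 h2.
have : (tri j + tri (d.+1 * j) == tri (j + d.+1 * j))%N.
  by rewrite -mulSn -E mulSn eqn_add2l eqn_leq h2 -(leq_add2l (tri j)) h1.
rewrite tri_add_eq ?muln_gt0 // => /andP[/eqP j1].
by rewrite j1 muln1 => /eqP[->].
Qed.

Lemma conv_tri (C D : nat -> rat) (k : nat) : (0 < k)%N ->
  conv tri C D k = C 0%N * D k + C k * D 0%N + (k == 2)%:R * (C 1%N * D 1%N).
Proof.
case: k => // k _; rewrite /conv big_ord_recl big_ord_recr /=.
rewrite subn0 add0n subnn addn0 !eqxx -[RHS]addrA; congr (_ + _).
rewrite addrC; congr (_ + _).
case: k => [|k]; first by rewrite big_ord0 mul0r.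
have mid (i : 'I_k.+1) : (tri (bump 0 i) + tri (k.+2 - bump 0 i) == tri k.+2)%N = (k == 0%N).
  rewrite /bump leq0n add1n subSS.
  have ik : (i <= k)%N by rewrite -ltnS.
  have -> : k.+2 = (i.+1 + (k.+1 - i))%N by lia.
  rewrite tri_add_eq ?subn_gt0 ?ltnS //.
  by apply/andP/eqP => [[/eqP h1 /eqP h2]|k0]; first lia; split; apply/eqP; lia.
case: k mid => [|k] mid.
  by rewrite big_ord_recl big_ord0 mid addr0 mul1r.
by rewrite mul0r big1 // => i _; rewrite mid.
Qed.

Lemma conv_tri0 (C D : nat -> rat) : conv tri C D 0 = C 0%N * D 0%N.
Proof. by rewrite /conv big_ord_recl big_ord0 addr0. Qed.

Lemma iter_conv_tri (C : nat -> rat) (k i : nat) : C 0%N = 0 ->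
  iter k (conv tri C) (fun i => (i == 0%N)%:R) i =
  match k with
  | 0 => (i == 0%N)%:R
  | 1 => C i
  | 2 => (i == 2)%:R * C 1%N ^+ 2
  | _ => 0
  end.
Proof.
move=> C0; case: k => [|k] //; elim: k i => [|k IH] i.
  case: i => [|i]; first by rewrite iterS conv_tri0 C0 mul0r.
  by rewrite iterS conv_tri //= C0 mul0r mulr1 !mulr0 add0r addr0.
case: i => [|i]; first by rewrite iterS conv_tri0 C0 mul0r; case: k {IH} => [|[|k]]; rewrite ?mul0r.
rewrite iterS conv_tri // !IH C0 mul0r add0r; case: k {IH} => [|[|k]] /=.
- by rewrite mulr0 add0r expr2.
- by rewrite !(mul0r, mulr0) addr0.
- by rewrite !(mul0r, mulr0) addr0.
Qed.

(** The sum in [ser_binomial] is the exponential of c C for the product [conv tri]; by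
    [iter_conv_tri] it stops at its quadratic term, which lives in degree 2. *)
Lemma ser_binomial_tri (n d : nat) (N : finFieldType -> nat)
    (U : finFieldType -> {poly rat}) (c : rat) (C : nat -> rat) :
  (0 < n)%N -> (0 < d)%N -> C 0%N = 0 ->
  (forall F, (U F)`_0 = 0) -> asym (fun F => (N F)%:R) d c ->
  ser n tri (fun F => #|F|%:R ^+ d *: U F) C ->
  ser n tri (fun F => (1 + U F) ^+ N F)
    (fun i => (i == 0%N)%:R + c * C i + (i == 2)%:R * (c * C 1%N) ^+ 2 / 2).
Proof.
move=> n0 d0 C0 U0 HN HU.
apply: ser_ext (ser_binomial (erefl : tri 0 = 0%N) tri_superadd d0 U0 HN HU) => // i ik.
under eq_bigr => k _ do rewrite iter_conv_tri //.
case: n n0 ik {HU} => // n _ ik.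
have f1 : 1`! = 1%N by [].
have f2 : 2`! = 2%N by [].
rewrite !big_ord_recl /= /bump /= fact0 expr0 expr1 f1 !divr1 mul1r addrA.
case: n ik => [|n] ik.
  rewrite big_ord0 addr0; case: i ik => [|[|i]] //= _; by rewrite !mul0r addr0.
rewrite big_ord_recl /= big1 ?addr0 => [|k _]; last by rewrite mulr0.
by congr (_ + _); rewrite exprMn; ring.
Qed.

Lemma local_weightE (Q : rat) (j : nat) :
  local_weight Q j = (-1) ^+ j * (Q ^+ (2 * 'C(j, 2)) / \prod_(i < j) (Q ^+ i.+1 - 1)).
Proof.
rewrite /local_weight; elim: j => [|j IH]; first by rewrite !big_ord0 bin0n muln0 !expr0 invr1 !mulr1.
rewrite !big_ord_recr /= IH binS bin1 mulnDr exprD [(-1) ^+ j.+1]exprS invfM; ring.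
Qed.

(** The factor q^d stands for the number of polynomials of degree [d]. The order is d + 2d C(j, 2) -
    d C(j+1, 2) = d (j-1)(j-2)/2. *)
Lemma asym_local_weight (d j : nat) : (0 < d)%N -> (0 < j)%N ->
  asym (fun F => #|F|%:R ^+ d * local_weight (#|F| ^ d)%:R j) (d * tri j) ((-1) ^+ j).
Proof.
move=> d0 j0; pose A : {poly rat} := 'X^(d + d * (2 * 'C(j, 2))).
pose B : {poly rat} := \prod_(i < j) ('X^(d * i.+1) - 1%:P).
have mB i : 'X^(d * i.+1) - 1%:P \is @monic rat.
  by apply: monicXnsubC; rewrite muln_gt0 d0.
have BE (F : finFieldType) : B.[#|F|%:R] = \prod_(i < j) ((#|F| ^ d)%:R ^+ i.+1 - 1).
  rewrite horner_prod; apply: eq_bigr => i _.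
  by rewrite hornerD hornerN hornerC hornerXn natrX exprM.
have B0 (F : finFieldType) : B.[#|F|%:R] != 0.
  rewrite BE; apply/prodf_neq0 => i _; rewrite subr_eq0 gt_eqF // exprn_egt1 //.
  by rewrite natrX exprn_egt1 ?gtn_eqF // ltr1n finRing_gt1.
have sB : size B = (d * 'C(j.+1, 2)).+1.
  rewrite /B; elim: (j) => [|l IH]; first by rewrite big_ord0 size_poly1 muln0.
  rewrite big_ord_recr /= size_Mmonic ?mB //; last by rewrite -size_poly_eq0 IH.
  rewrite IH size_XnsubC ?muln_gt0 ?d0 // [in RHS]binS bin1 mulnDr.
  by rewrite addSn addnS.
have szA : size A = (size B + d * tri j)%N.
  rewrite size_polyXn sB; case: j j0 {B mB BE B0 sB A} => // j _.
  have E1 : 'C(j.+1, 2) = ('C(j, 2) + j)%N by rewrite binS bin1.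
  have E2 : 'C(j.+2, 2) = ('C(j.+1, 2) + j.+1)%N by rewrite binS bin1.
  by rewrite /tri /= E2 E1; nia.
have := asym_scale ((-1) ^+ j) (asym_frac B0 (monicXn _ _) _ szA).
rewrite mulr1 => H; apply: asym_ext (H _) => [F|]; last first.
  by apply: monic_prod => i _; apply: mB.
rewrite BE hornerXn local_weightE exprD [_ ^+ (d * _)]exprM -natrX.
by rewrite mulrCA !mulrA.
Qed.

Definition weight_series (F : finFieldType) (n d : nat) : {poly rat} :=
  \sum_(j < n.+1) local_weight (#|F| ^ d)%:R j *: 'X^(j * d).

Lemma coef_weight_series (F : finFieldType) (n d i : nat) : (0 < d)%N -> (i <= n)%N ->
  (weight_series F n d)`_i =
  if (d %| i)%N then local_weight (#|F| ^ d)%:R (i %/ d) else 0.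
Proof.
move=> d0 ik; rewrite coef_sum; case: ifP => di; last first.
  rewrite big1 // => j _; rewrite coefZ coefXn; case: eqP => [E|]; last by rewrite mulr0.
  by rewrite E dvdn_mull in di.
have lti : (i %/ d < n.+1)%N by rewrite ltnS (leq_trans (leq_div _ _)).
rewrite (bigD1 (Ordinal lti)) //= coefZ coefXn divnK // eqxx mulr1 big1 ?addr0 // => j nj.
rewrite coefZ coefXn; case: eqP => [E|]; last by rewrite mulr0.
by case/eqP: nj; apply: val_inj => /=; rewrite E mulnK.
Qed.

(* The coefficient of x^i in q^d (weight_series d - 1) has order at most tri i, with
   equality when d * tri (i %/ d) = tri i. *)
Definition weight_lead (d i : nat) : rat :=
  if [&& (0 < i)%N, (d %| i)%N & (d * tri (i %/ d) == tri i)%N]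
  then (-1) ^+ (i %/ d) else 0.

Lemma ser_weight (n d : nat) : (0 < d)%N ->
  ser n tri (fun F => #|F|%:R ^+ d *: (weight_series F n d - 1)) (weight_lead d).
Proof.
move=> d0 i ik.
have E (F : finFieldType) : (#|F|%:R ^+ d *: (weight_series F n d - 1))`_i =
    if (0 < i)%N && (d %| i)%N then #|F|%:R ^+ d * local_weight (#|F| ^ d)%:R (i %/ d)
    else 0.
  rewrite coefZ coefB coef1 coef_weight_series //.
  case: i {ik} => [|i] /=; last by rewrite subr0; case: ifP; rewrite ?mulr0.
  by rewrite dvdn0 div0n /local_weight big_ord0 subrr mulr0.
apply: asym_ext E _; rewrite /weight_lead andbA.
case: (boolP ((0 < i)%N && (d %| i)%N)) => [/andP[i0 di]|_] /=; last exact: asym_zero.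
have id0 : (0 < i %/ d)%N by rewrite divn_gt0 // dvdn_leq.
have le : (d * tri (i %/ d) <= tri i)%N.
  by apply: leq_trans (tri_mul _ _) _; rewrite mulnC divnK.
exact: asym_liftW (asym_local_weight d0 id0) le.
Qed.

Lemma weight_lead1 (i : nat) : weight_lead 1 i = if i == 0%N then 0 else (-1) ^+ i.
Proof. by rewrite /weight_lead dvd1n divn1 mul1n eqxx lt0n; case: eqP. Qed.

Lemma weight_lead2 (i : nat) : weight_lead 2 i = - (i == 2)%:R.
Proof.
rewrite /weight_lead; have [i0|i0] := posnP i; first by rewrite i0 oppr0.
have [di|di] := boolP (2 %| i)%N; last first.
  by case: (i =P 2) di => [->|_] //; rewrite oppr0.
case/dvdnP: di i0 => j -> j0; rewrite muln_gt0 andbT in j0.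
rewrite /= mulnK // [(j * 2)%N]mulnC tri_mul_eq //=.
have -> : (2 * j == 2)%N = (j == 1%N) by apply/eqP/eqP; lia.
by case: eqP => [->|]; rewrite ?oppr0.
Qed.

Lemma weight_lead_ge3 (d i : nat) : (2 < d)%N -> weight_lead d i = 0.
Proof.
move=> d2; rewrite /weight_lead; case: ifP => // /and3P[i0 di].
case/dvdnP: di i0 => j ->; rewrite muln_gt0 => /andP[j0 d0].
by rewrite mulnK // [(j * d)%N]mulnC tri_mul_eq ?(ltnW d2) // (gtn_eqF d2).
Qed.

Lemma irr_count_unit0 (F : finFieldType) (n : nat) : irr_count_unit F n 0 = 0%N.
Proof. by apply: eq_card0 => i; rewrite !inE eqn0Ngt irr_deg_gt0. Qed.

Lemma irr_count_unit1 (F : finFieldType) (n : nat) : (0 < n)%N ->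
  (irr_count_unit F n 1)%:R = #|F|%:R - 1 :> rat.
Proof.
move=> n0; rewrite -(irr_count1 F n0).
have rX : rVpoly (poly_rV 'X : 'rV[F]_n.+1) = 'X by rewrite poly_rV_K // size_polyX.
have PX : (rVpoly (poly_rV 'X : 'rV[F]_n.+1) \is monic) &&
    irreducibleb (rVpoly (poly_rV 'X : 'rV[F]_n.+1)).
  rewrite rX monicX; apply/irreducibleP; rewrite -['X]subr0; exact: irredp_XsubC.
pose iX : irr_type F n :=
  exist (fun v : 'rV[F]_n.+1 => (rVpoly v \is monic) && irreducibleb (rVpoly v)) _ PX.
have EX : irr_poly iX = 'X by [].
have dX : irr_deg iX = 1%N by rewrite /irr_deg EX size_polyX.
suff -> : irr_count F n 1 = (1 + irr_count_unit F n 1)%N by rewrite natrD addrC addKr.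
rewrite /irr_count (cardsD1 iX) inE dX; congr (_ + _)%N.
apply: eq_card => i; rewrite !inE /= andbC; congr (_ && _).
by rewrite -EX (inj_eq (@irr_poly_inj F n)).
Qed.

Lemma irr_count_unit_ge2 (F : finFieldType) (n d : nat) : (1 < d)%N ->
  irr_count_unit F n d = irr_count F n d.
Proof.
move=> d1; apply: eq_card => i; rewrite !inE; case: eqP => //= id.
by apply: contraTneq d1 => iX; rewrite -id /irr_deg iX size_polyX.
Qed.

(** For d = 1, the powers (X-a)^i give the sign (-1)^i and the pairs of distinct linear factors an
    extra 1/2 in degree 2; for d = 2, the quadratics give -1/2 there; for larger d nothing reaches
    the top order. *)
Lemma ser_weight_exp (n d : nat) : (0 < d <= n)%N ->
  ser n tri (fun F => weight_series F n d ^+ irr_count_unit F n d)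
    (fun i => if d == 1%N then (-1) ^+ i + (i == 2)%:R / 2
              else if d == 2 then (i == 0%N)%:R - (i == 2)%:R / 2 else (i == 0%N)%:R).
Proof.
move=> /andP[d0 dn]; have n0 := leq_trans d0 dn.
have U0 (F : finFieldType) : (weight_series F n d - 1)`_0 = 0.
  by rewrite coefB coef1 coef_weight_series // dvdn0 div0n /local_weight big_ord0 subrr.
have C0 : weight_lead d 0 = 0 by [].
have main c : asym (fun F => (irr_count_unit F n d)%:R) d c ->
    ser n tri (fun F => weight_series F n d ^+ irr_count_unit F n d)
    (fun i => (i == 0%N)%:R + c * weight_lead d i +
      (i == 2)%:R * (c * weight_lead d 1%N) ^+ 2 / 2).
  move=> Hc; have H := ser_binomial_tri n0 d0 C0 U0 Hc (@ser_weight n d d0).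
  by apply: ser_ext H => // F i _; rewrite addrC subrK.
have [d1|d1] := eqVneq d 1%N.
  subst d; have H1 : asym (fun F => (irr_count_unit F n 1)%:R) 1 1.
    apply: (asym_ext (psi := fun F => #|F|%:R ^+ 1 + (-1))).
      by move=> F; rewrite irr_count_unit1.
    rewrite -[X in asym _ _ X]addr0; apply: asym_add (asym_card_exp 1) _.
    by apply: asym_lift (asym_const _) _.
  apply: ser_ext (main _ H1) => // i _.
  rewrite !weight_lead1 /= !mul1r sqrrN expr1n mulr1.
  by case: i => [|i]; rewrite /= ?addr0 ?add0r // expr0.
have [d2|d2] := eqVneq d 2.
  subst d; have H2 : asym (fun F => (irr_count_unit F n 2)%:R) 2 2^-1.
    apply: (asym_ext (psi := fun F => 2^-1 * (#|F|%:R ^+ 2 + (-1) * #|F|%:R ^+ 1))).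
      by move=> F; rewrite irr_count_unit_ge2 // irr_count2 // mulN1r.
    rewrite -[X in asym _ _ X]mulr1; apply: asym_scale.
    rewrite -[X in asym _ _ X]addr0; apply: asym_add (asym_card_exp 2) _.
    by apply: (asym_lift (k := 1)) => //; apply: asym_scale (asym_card_exp 1).
  apply: ser_ext (main _ H2) => // i _.
  by rewrite !weight_lead2; case: (i == 2); rewrite /= ?mulr0n ?mulr1n; field.
have d3 : (2 < d)%N by rewrite ltn_neqAle eq_sym d2 ltn_neqAle eq_sym d1.
have [|c Hc] := @asym_irr_count n d; first by rewrite d0.
have Hc' : asym (fun F => (irr_count_unit F n d)%:R) d c.
  by apply: asym_ext Hc => F; rewrite irr_count_unit_ge2 // ltnW.
apply: ser_ext (main _ Hc') => // i _.
by rewrite !weight_lead_ge3 // mulr0 addr0 expr2 !(mul0r, mulr0) addr0.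
Qed.

Lemma asym_weight_product (n : nat) : (0 < n)%N ->
  asym (fun F => (\prod_(d < n.+1) weight_series F n d ^+ irr_count_unit F n d)`_n)
    (tri n) ((-1) ^+ n).
Proof.
move=> n0.
have H1 : ser n tri (fun F => \prod_(d < 2) weight_series F n d ^+ irr_count_unit F n d)
    (fun i => (-1) ^+ i + (i == 2)%:R / 2).
  have := @ser_weight_exp n 1; rewrite n0 => /(_ isT) H.
  apply: ser_ext H => // F i _.
  by rewrite !big_ord_recl big_ord0 irr_count_unit0 expr0 mulr1 mul1r.
(* For n = 1 the product has no factor d = 2 to cancel the 1/2, but that term sits in degree 2. *)
have [n1|n1] := eqVneq n 1%N.
  have := H1 n (leqnn n); rewrite n1 /= mul0r addr0; exact.
have n2 : (1 < n)%N by rewrite ltn_neqAle eq_sym n1.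
have Hm m : (2 < m <= n.+1)%N ->
    ser n tri (fun F => \prod_(d < m) weight_series F n d ^+ irr_count_unit F n d)
      (fun i => (-1) ^+ i).
  elim: m => // m IH /andP[m2 mn].
  have m0 : (0 < m)%N by move: m2; case: (m).
  have := @ser_weight_exp n m; rewrite m0 => /(_ mn) Hd.
  have [m2'|m2'] := eqVneq m 2.
    subst m; have H := ser_mul tri_superadd H1 Hd.
    apply: ser_ext H => [F i _|i _]; first by rewrite [in LHS]big_ord_recr.
    case: i => [|i]; first by rewrite conv_tri0 /= !expr0; field.
    by rewrite conv_tri //= expr0 expr1 ?mulr0n ?mulr1n; field.
  have m3 : (2 < m)%N by rewrite ltn_neqAle eq_sym m2'.
  have H := ser_mul tri_superadd (IH _) Hd; rewrite m3 (ltnW mn) in H.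
  apply: ser_ext (H isT) => [F i _|i _]; first by rewrite [in LHS]big_ord_recr.
  rewrite (gtn_eqF m3) (gtn_eqF (ltnW m3)).
  case: i => [|i]; first by rewrite conv_tri0 /= !expr0 mulr1.
  by rewrite conv_tri //= !mulr0 mulr1 add0r addr0.
by have := Hm n.+1; rewrite ltnS n2 leqnn => /(_ isT n (leqnn n)).
Qed.

(** * Polynomiality *)

Lemma horner_bound (R : realFieldType) (p : {poly R}) (k : nat) : (size p <= k.+1)%N ->
  exists2 C, 0 <= C & forall x, 1 <= x -> `|p.[x]| <= C * x ^+ k.
Proof.
move=> sp; exists (\sum_(i < size p) `|p`_i|); first by apply: sumr_ge0.
move=> x x1; have x0 : 0 <= x by apply: le_trans x1.
rewrite horner_coef (le_trans (ler_norm_sum _ _ _)) // mulr_suml; apply: ler_sum => i _.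
rewrite normrM normrX (ger0_norm x0) ler_wpM2l // ler_weXn2l //.
by rewrite -ltnS (leq_trans (ltn_ord i)).
Qed.

Lemma horner_dominates (R B : {poly rat}) : (size R < size B)%N ->
  exists M : nat, forall x : nat, (M <= x)%N -> `|R.[x%:R]| < `|B.[x%:R]|.
Proof.
case sB: (size B) => [|[|b]] // sR.
  have R0 : R = 0 by apply/eqP; rewrite -size_poly_eq0 -leqn0.
  exists 0%N => x _; have /eqP/size_poly1P[c c0 ->] := sB.
  by rewrite R0 horner0 normr0 hornerC normr_gt0.
have lB : lead_coef B != 0 by rewrite lead_coef_eq0 -size_poly_eq0 sB.
pose B' := B - lead_coef B *: 'X^(b.+1).
have sB' : (size B' <= b.+1)%N.
  apply/leq_sizeP => j bj; rewrite coefB coefZ coefXn.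
  have [->|nj] := eqVneq j b.+1; first by rewrite mulr1 lead_coefE sB subrr.
  by rewrite mulr0 subr0 nth_default // sB ltn_neqAle eq_sym nj.
have [C C0 HC] := horner_bound sR; have [C' C0' HC'] := horner_bound sB'.
have l0 : 0 < `|lead_coef B| by rewrite normr_gt0.
have q0 : 0 <= (C + C') / `|lead_coef B| by rewrite divr_ge0 ?addr_ge0.
exists (Num.bound ((C + C') / `|lead_coef B|)).+1 => x Mx.
have x1 : 1 <= x%:R :> rat by rewrite ler1n (leq_trans _ Mx).
have xb : C + C' < `|lead_coef B| * x%:R.
  rewrite mulrC -ltr_pdivrMr //; apply: lt_le_trans (archi_boundP q0) _.
  by rewrite ler_nat ltnW.
have EB : B.[x%:R] = lead_coef B * x%:R ^+ b.+1 + B'.[x%:R].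
  by rewrite /B' hornerD hornerN hornerZ hornerXn addrC subrK.
have h1 : `|lead_coef B| * x%:R ^+ b.+1 - `|B'.[x%:R]| <= `|B.[x%:R]|.
  rewrite EB -[in X in X - _](ger0_norm (exprn_ge0 b.+1 (ler0n _ x))) -normrM.
  exact: lerB_normD.
apply: le_lt_trans (HC _ x1) _; apply: lt_le_trans h1.
rewrite ltrBrDr; apply: (le_lt_trans (lerD (lexx _) (HC' _ x1))).
by rewrite -mulrDl exprS mulrA ltr_pM2r // exprn_gt0 // (lt_le_trans ltr01).
Qed.

Lemma horner_int (q : {poly int}) (x : nat) :
  (map_poly (intr : int -> rat) q).[x%:R] \is a Num.int.
Proof.
by rewrite -[x%:R]/((x : int)%:~R) horner_map /= intr_int.
Qed.

(** Write A = P B + R and let [a] clear the denominators of P. Then a R/B = a phi - a P is an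
    integer at every prime, yet smaller than 1 in absolute value at large ones, so it vanishes
    there; this contradicts R being nonzero. *)
Lemma asym_integral (phi : finFieldType -> rat) (k : nat) :
  asym phi k 1 -> (forall F, phi F \is a Num.int) ->
  exists P : {poly rat}, [/\ P \is monic, size P = k.+1 &
    forall F : finFieldType, phi F = P.[#|F|%:R]].
Proof.
move=> [A [B [B0 phiE sA]]] phi_int; have nB := asym_den_neq0 B0.
pose P : {poly rat} := A %/ B; pose R : {poly rat} := A %% B.
have AE : A = P * B + R by exact: divp_eq.
have sR : (size R < size B)%N by rewrite ltn_modp.
have [q [a a0 Pq]] := rat_poly_scale P.
have a0' : a%:~R != 0 :> rat by rewrite intr_eq0.
have R0 : R = 0.
  apply/eqP; apply: contraT => nR.
  have [M HM] : exists M : nat, forall x : nat, (M <= x)%N ->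
      `|(a%:~R *: R).[x%:R]| < `|B.[x%:R]|.
    by apply: horner_dominates; rewrite size_scale.
  (* Comparing [R] with 0 says that a nonzero [R] has no large natural root. *)
  have [M' HM'] : exists M : nat, forall x : nat, (M <= x)%N -> `|(0 : {poly rat}).[x%:R]| < `|R.[x%:R]|.
    by apply: horner_dominates; rewrite size_poly0 size_poly_gt0.
  have [p pM pp] := prime_above (M + M').
  have := HM p; have := HM' p; rewrite horner0 normr0 normr_gt0 hornerZ => h2 h1.
  have {}h1 := h1 (leq_trans (leq_addr _ _) (ltnW pM)).
  have {}h2 := h2 (leq_trans (leq_addl _ _) (ltnW pM)).
  have := phiE 'F_p; have := B0 'F_p; have := phi_int 'F_p.
  rewrite card_Fp // AE hornerD hornerM => pint Bp pE.
  have E : a%:~R * R.[p%:R] / B.[p%:R] = a%:~R * phi 'F_p - (map_poly intr q).[p%:R].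
    have -> : (map_poly intr q).[p%:R] = a%:~R * P.[p%:R].
      by rewrite Pq hornerZ mulrA mulfV // mul1r.
    by rewrite pE; field.
  have I : a%:~R * R.[p%:R] / B.[p%:R] \is a Num.int.
    by rewrite E rpredB ?horner_int // rpredM ?intr_int.
  have lt1 : `|a%:~R * R.[p%:R] / B.[p%:R]| < 1.
    by rewrite normrM normfV ltr_pdivrMr ?normr_gt0 // mul1r.
  have : a%:~R * R.[p%:R] / B.[p%:R] == 0.
    case/intrP: I lt1 => m ->; rewrite -intr_norm (ltrz1 rat) intr_eq0.
    by rewrite -abszE ltz_nat ltnS leqn0 absz_eq0.
  by rewrite !mulf_eq0 invr_eq0 (negbTE a0') (negbTE Bp) (negbTE h2).
have AP : A = P * B by rewrite AE R0 addr0.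
have sP : (size (P - 'X^k)%R <= k)%N.
  have [->|nP] := eqVneq (P - 'X^k) 0; first by rewrite size_poly0.
  move: sA; rewrite scale1r AP -mulrBl size_mul //.
  by have : (0 < size B)%N; [rewrite size_poly_gt0|move: (size B) (size (P - _)); lia].
have PE : P = 'X^k + (P - 'X^k) by rewrite addrC subrK.
exists P; split.
- by rewrite PE monicE lead_coefDl ?lead_coefXn // size_polyXn.
- by rewrite PE size_polyDl size_polyXn.
by move=> F; rewrite phiE AP hornerM mulfK.
Qed.

(** * Return to the Steinberg character *)

Lemma steinberg_vchar (n : nat) (F : finFieldType) :
  steinberg n F \in 'Z[irr 'GL_n[F]]%g.
Proof.
rewrite /steinberg rpred_sum // => J _; rewrite rpredZsign cfInd_vchar //.
exact: cfun1_vchar.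
Qed.

Lemma sum_GL (n : nat) (F : finFieldType) (R : nmodType) (f : 'M[F]_n.-1.+1 -> R) :
  \sum_(x in 'GL_n[F]%g) f (GLval x) = \sum_(g : 'M[F]_n.-1.+1 | g \in unitmx) f g.
Proof.
rewrite [RHS](reindex (fun x : {'GL_n[F]} => GLval x)) /=; last first.
  exists (insubd (1%g : {'GL_n[F]})) => [x _|g ug]; first exact: valKd.
  by rewrite -[LHS]/(val _) insubdK.
by apply: eq_bigl => x; rewrite inE GL_unitmx.
Qed.

Lemma cfdot_steinberg_cube (n : nat) (F : finFieldType) : (0 < n)%N ->
  '[steinberg n F * steinberg n F * steinberg n F, 1]_('GL_n[F]) =
  ratr ((-1) ^+ n * ((\sum_(g : 'M[F]_n.-1.+1 | g \in unitmx) moebius g 1%:M ^+ 3) /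
    (card_unitmx F n.-1.+1)%:R)).
Proof.
move=> n0; rewrite cfdotE.
have -> : #|'GL_n[F]%g| = card_unitmx F n.-1.+1.
  rewrite -sum1_card (sum_GL (n := n) (fun _ => 1%N)) /card_unitmx -sum1_card.
  by apply: eq_bigl => g; rewrite inE.
set S := \sum_(g : 'M[F]_n.-1.+1 | g \in unitmx) moebius g 1%:M ^+ 3.
have -> : \sum_(x in 'GL_n[F]%g) (steinberg n F * steinberg n F * steinberg n F) x *
    ((1 : 'CF('GL_n[F])) x)^* = ratr ((-1) ^+ n * S).
  rewrite /S [(-1) ^+ n * \sum_(g | _) _]mulr_sumr rmorph_sum /= -(sum_GL (n := n) (fun g => ratr ((-1) ^+ n * moebius g 1%:M ^+ 3))).
  apply: eq_bigr => x xG; rewrite cfun1E xG rmorph1 mulr1 !cfunE steinbergE //.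
  rewrite -!rmorphM; congr ratr.
  have s2 : (-1) ^+ n * (-1) ^+ n = 1 :> rat by rewrite -expr2 sqrr_sign.
  move: s2; set s : rat := (-1) ^+ n; set mu := moebius _ _ => s2.
  by transitivity (s * s * (s * mu ^+ 3)); [ring|rewrite s2 mul1r].
by rewrite [(-1) ^+ n * (S / _)]mulrA [RHS]rmorphM fmorphV rmorph_nat mulrC.
Qed.

Lemma tri_half (n : nat) : (0 < n)%N -> tri n = (((n - 1) * (n - 2)) %/ 2)%N.
Proof. by move=> n0; rewrite /tri bin2 divn2 subn1 subn2. Qed.

Theorem corollary1p2p6 (n : nat) (hn : (1 <= n)%N) :
  exists P : {poly rat},
    [/\ P \is monic,
        size P = (((n - 1) * (n - 2)) %/ 2).+1
      & forall F : finFieldType,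
          '[steinberg n F * steinberg n F * steinberg n F, 1]_('GL_n[F])
            = ratr P.[#|F|%:R] ].
Proof.
pose phi (F : finFieldType) : rat := (-1) ^+ n *
  (\prod_(d < n.+1) weight_series F n d ^+ irr_count_unit F n d)`_n.
have phiE (F : finFieldType) :
    '[steinberg n F * steinberg n F * steinberg n F, 1]_('GL_n[F]) = ratr (phi F).
  rewrite cfdot_steinberg_cube // sum_moebius_cube prednK //.
have phi_asym : asym phi (tri n) 1.
  rewrite -[1](sqrr_sign rat n) expr2.
  exact: asym_scale (asym_weight_product hn).
have phi_int F : phi F \is a Num.int.
  (* Integrality comes from representation theory: an inner product of virtual characters is an
     integer. *)
  rewrite -Cint_rat -phiE Cint_cfdot_vchar ?cfun1_vchar //.
  by rewrite !rpredM ?steinberg_vchar.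
have [P [mP sP EP]] := asym_integral phi_asym phi_int.
exists P; split=> //; first by rewrite sP tri_half.
by move=> F; rewrite phiE EP.
Qed.
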